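(* Let $\mathcal{A}$ be a finite alphabet, $\Omega=\mathcal{A}^{\mathbb{N}}$, $\sigma$ the shift on $\Omega$, and $\mu$ a $\sigma$-invariant ergodic Borel probability measure on $\Omega$. Let $Z$ be a coarsely optimal compression algorithm. Then for $\mu$-almost every $\omega\in\Omega$, \[ K_Z(\omega)=\hat H(\omega)=K_{AIC}(\omega)=h_\mu(\sigma), \] where $h_\mu(\sigma)$ is the Kolmogorov–Sinai entropy of $(\Omega,\mu,\sigma)$.
   Context: All logarithms are in base 2 and entropies are computed with base-2 logarithms. $\Sigma(\mathcal{A})$ denotes the set of finite strings over $\mathcal{A}$ (including the empty string), and $|s|$ the length of a string $s$. For $\omega=(\omega_i)_{i\ge1}\in\Omega$, $\omega^n=(\omega_1,\dots,\omega_n)$. Algorithmic Information Content: fix a universal partial recursive function $U:\Sigma(\{0,1\})\to\Sigma(\mathcal{A})$; $I_{AIC}(s)=\min\{|p|: U(p)=s\}$, and $K_{AIC}(\omega)=\limsup_{n\to\infty} I_{AIC}(\omega^n)/n$. A compression algorithm is a total recursive injective (lossless) map $Z:\Sigma(\mathcal{A})\to\Sigma(\{0,1\})$; $K_Z(\omega)=\limsup_{n\to\infty}|Z(\omega^n)|/n$. Empirical entropy: for a string $s$ of length $n$, a word $w\in\mathcal{A}^l$ ($l\le n$), let $P(s,w)=\frac{1}{n-l+1}\#\{0\le i\le n-l: (s_{i+1},\dots,s_{i+l})=w\}$ and $\hat H_l(s)=-\frac1l\sum_{w\in\mathcal{A}^l}P(s,w)\log P(s,w)$ (with $0\log 0=0$).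 For $\omega\in\Omega$, $\hat H_l(\omega)=\limsup_{n\to\infty}\hat H_l(\omega^n)$ and $\hat H(\omega)=\lim_{l\to\infty}\hat H_l(\omega)$ (this limit exists). $Z$ is coarsely optimal if for every $k\ge1$ there is a function $f_k$ with $f_k(n)=o(n)$ such that for every finite string $s$, $|Z(s)|\le |s|\hat H_k(s)+f_k(|s|)$. *)

(* Defs.v *)
From HB Require Import structures.
From mathcomp Require Import all_boot all_order all_algebra.
From mathcomp Require Import all_classical all_reals all_analysis.
Set Implicit Arguments. Unset Strict Implicit. Unset Printing Implicit Defensive.
Import Order.TTheory GRing.Theory Num.Theory numFieldNormedType.Exports.
Local Open Scope classical_set_scope.
Local Open Scope ring_scope.

(* Partial recursive functions (mu-recursive functions on nat), with a       *)
(* relational big-step semantics.  Arguments are lists of naturals; a        *)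
(* missing argument reads as 0 (this does not change the computable class).  *)
Inductive recfun : Type :=
| RZero
| RSucc
| RProj of nat
| RComp of recfun & list recfun
| RPrec of recfun & recfun
| RMin of recfun.

Inductive reval : recfun -> seq nat -> nat -> Prop :=
| ev_zero xs : reval RZero xs 0
| ev_succ xs : reval RSucc xs (head 0%N xs).+1
| ev_proj i xs : reval (RProj i) xs (nth 0%N xs i)
| ev_comp f gs xs ys y :
    revals gs xs ys -> reval f ys y -> reval (RComp f gs) xs y
| ev_prec0 f g xs y :
    reval f xs y -> reval (RPrec f g) (0%N :: xs) y
| ev_precS f g n xs z y :
    reval (RPrec f g) (n :: xs) z -> reval g [:: n, z & xs] y ->
    reval (RPrec f g) (n.+1 :: xs) y
| ev_min f xs y :
    reval f (y :: xs) 0 ->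
    (forall z, (z < y)%N -> exists2 v, reval f (z :: xs) v & v <> 0%N) ->
    reval (RMin f) xs y
with revals : list recfun -> seq nat -> seq nat -> Prop :=
| evs_nil xs : revals [::] xs [::]
| evs_cons g gs xs y ys :
    reval g xs y -> revals gs xs ys -> revals (g :: gs) xs (y :: ys).

(* Bijective base-#|A| numeration of the finite strings over a finite type. *)
Fixpoint str_code (A : finType) (s : seq A) : nat :=
  match s with
  | [::] => 0%N
  | a :: s' => (enum_rank a).+1 + #|A| * str_code s'
  end.

Definition partial_recursive (A B : finType) (f : seq A -> option (seq B)) :=
  exists e : recfun, forall x y,
    f x = Some y <-> reval e [:: str_code x] (str_code y).

Definition total_recursive (A B : finType) (f : seq A -> seq B) :=
  exists e : recfun, forall x, reval e [:: str_code x] (str_code (f x)).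

(* Universal partial recursive function U : Sigma({0,1}) -> Sigma(A):
   partial recursive and additively optimal (invariance theorem form). *)
Definition universal (A : finType) (U : seq bool -> option (seq A)) :=
  partial_recursive U /\
  forall V : seq bool -> option (seq A), partial_recursive V ->
    exists c : nat, forall p s, V p = Some s ->
      exists2 q, U q = Some s & (size q <= size p + c)%N.

Definition compression_algorithm (A : finType) (Z : seq A -> seq bool) :=
  total_recursive Z /\ injective Z.

Section Entropy_fun.
Variable R : realType.
Definition log2 (x : R) : R := ln x / ln 2.
Definition xlogx (p : R) : R := if p == 0 then 0 else p * log2 p.
End Entropy_fun.

Section Strings.
Variables (R : realType) (A : finType).

(* omega^n = (omega_1, ..., omega_n); sequences are indexed from 0. *)
Definition prefix (w : nat -> A) (n : nat) : seq A := mkseq w n.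

(* I_AIC(s) = min { |p| : U p = s }  (+oo if no such p) *)
Definition I_AIC (U : seq bool -> option (seq A)) (s : seq A) : \bar R :=
  ereal_inf [set ((size p)%:R)%:E | p in [set p | U p = Some s]].

Definition K_AIC (U : seq bool -> option (seq A)) (w : nat -> A) : \bar R :=
  limn_esup (fun n => I_AIC U (prefix w n) * ((n%:R)^-1)%:E)%E.

Definition K_Z (Z : seq A -> seq bool) (w : nat -> A) : \bar R :=
  limn_esup (fun n => ((size (Z (prefix w n)))%:R / n%:R)%:E).

Definition emp_freq (s : seq A) (l : nat) (w : l.-tuple A) : R :=
  (#|[set i : 'I_(size s - l).+1 | take l (drop i s) == tval w]|)%:R
  / ((size s - l).+1)%:R.

Definition emp_entropy (l : nat) (s : seq A) : R :=
  - (l%:R)^-1 * \sum_(w : l.-tuple A) xlogx (emp_freq s w).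

Definition Hhat_l (l : nat) (w : nat -> A) : \bar R :=
  limn_esup (fun n => (emp_entropy l (prefix w n))%:E).

Definition Hhat (w : nat -> A) : \bar R := limn (fun l => Hhat_l l w).

Definition coarsely_optimal (Z : seq A -> seq bool) :=
  forall k : nat, (1 <= k)%N ->
    exists f : nat -> R,
      (fun n => f n / n%:R) @ \oo --> (0 : R) /\
      forall s : seq A, (k <= size s)%N ->
        (size (Z s))%:R <= (size s)%:R * emp_entropy k s + f (size s).
End Strings.

(* The full shift Omega = A^N with the sigma-algebra generated by cylinders  *)
(* (= Borel sigma-algebra of the product topology).                          *)
(* the alphabet, equipped with a distinguished point a0 (needed only to give
   the carrier of Omega the pointedType structure required by the library) *)
Definition palph (A : finType) (a0 : A) : Type := A.
HB.instance Definition _ (A : finType) (a0 : A) := Finite.on (palph a0).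
HB.instance Definition _ (A : finType) (a0 : A) := isPointed.Build (palph a0) a0.
Definition seqspace (A : finType) (a0 : A) := nat -> palph a0.

Definition cylinders (A : finType) (a0 : A) : set (set (seqspace a0)) :=
  [set C | exists (i : nat) (a : A), C = [set w : (seqspace a0) | w i = a]].
Arguments cylinders {A} a0.

Notation Omega a0 := (g_sigma_algebraType (cylinders a0)).

Definition shift (A : finType) (a0 : A) (w : Omega a0) : Omega a0 :=
  fun i => w i.+1.
Arguments shift {A a0} w.

Section KS.
Variables (R : realType) (A : finType) (a0 : A).
Local Notation Om := (Omega a0).

Definition shift_invariant (mu : probability Om R) :=
  forall B : set Om, measurable B -> mu (shift @^-1` B) = mu B.

Definition ergodic (mu : probability Om R) :=
  forall B : set Om, measurable B -> shift @^-1` B = B ->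
    mu B = 0%E \/ mu B = 1%E.

Definition is_partition (I : finType) (P : I -> set Om) :=
  (forall i, measurable (P i)) /\
  (forall i j, i != j -> P i `&` P j = set0) /\
  \bigcup_(i in [set: I]) P i = [set: Om].

Definition part_entropy (mu : probability Om R) (I : finType) (P : I -> set Om) : R :=
  - \sum_(i : I) xlogx (fine (mu (P i))).

Definition join_part (I : finType) (P : I -> set Om) (n : nat)
    (t : n.-tuple I) : set Om :=
  \bigcap_(k in [set k : 'I_n | True]) ((iter k shift) @^-1` P (tnth t k)).

Definition ent_rate (mu : probability Om R) (I : finType) (P : I -> set Om) : R :=
  limn (fun n => part_entropy mu (@join_part I P n) / n%:R).

Definition KS_entropy (mu : probability Om R) : \bar R :=
  ereal_sup [set x | exists (I : finType) (P : I -> set Om),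
                       is_partition P /\ x = (ent_rate mu P)%:E].
End KS.

(* Main.v *)
Require Import Defs.
From HB Require Import structures.
From mathcomp Require Import all_boot all_order all_algebra.
From mathcomp Require Import all_classical all_reals all_analysis.
From mathcomp Require Import zify lra.
Import Order.TTheory GRing.Theory Num.Theory numFieldNormedType.Exports.
Local Open Scope classical_set_scope.
Local Open Scope ring_scope.

(** All four quantities are squeezed around the entropy rate [h] of the process
    of letters.
    Upper bounds: by Birkhoff's theorem (in the form of the Katznelson-Weiss
    covering argument) the empirical frequencies of every word converge almost
    surely to its probability, so that the empirical entropy of order [l] tends
    to [H_l / l], where [H_l] is the entropy of the blocks of length [l]; since
    [H_l / l] tends to [h] by subadditivity (Fekete), coarse optimality makes
    the limsup of [|Z(w^n)| / n] at most [h].  Inverting [Z] by unbounded search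
    is partial recursive, hence [I_AIC <= |Z| + O(1)].
    Lower bound: at most [2^m] words have complexity [m], so Gibbs' inequality
    gives [H_n <= E I_AIC(w^n) + O(log n)].  As [I_AIC(w^n) / n] is bounded and
    almost surely eventually below [h + eta], a mean which is at least [h - o(1)]
    forbids that it stays below [h - eps] with positive probability.
    Finally [h] is the Kolmogorov-Sinai entropy: a finite partition is
    approximated by a function of a block of letters, and Gibbs' inequality is
    applied to the output of a noisy channel fed with this approximation. *)

Set Implicit Arguments.
Unset Strict Implicit.
Unset Printing Implicit Defensive.

(** * Computability *)

(* The automatically generated schemes give no induction hypothesis under the
   nested [exists2] of [ev_min]. *)
Section RevalInduction.
Variables (P : recfun -> seq nat -> nat -> Prop)
  (Q : seq recfun -> seq nat -> seq nat -> Prop).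
Hypotheses
  (Pzero : forall xs, P RZero xs 0%N)
  (Psucc : forall xs, P RSucc xs (head 0%N xs).+1)
  (Pproj : forall i xs, P (RProj i) xs (nth 0%N xs i))
  (Pcomp : forall f gs xs ys y, Q gs xs ys -> P f ys y -> P (RComp f gs) xs y)
  (Pprec0 : forall f g xs y, P f xs y -> P (RPrec f g) (0%N :: xs) y)
  (PprecS : forall f g n xs z y, P (RPrec f g) (n :: xs) z ->
     P g [:: n, z & xs] y -> P (RPrec f g) (n.+1 :: xs) y)
  (Pmin : forall f xs y, P f (y :: xs) 0%N ->
     (forall z, (z < y)%N -> exists2 v, P f (z :: xs) v & v <> 0%N) ->
     P (RMin f) xs y)
  (Qnil : forall xs, Q [::] xs [::])
  (Qcons : forall g gs xs y ys, P g xs y -> Q gs xs ys -> Q (g :: gs) xs (y :: ys)).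

Fixpoint reval_nested_ind f xs y (ev : reval f xs y) : P f xs y :=
  match ev with
  | ev_zero xs => Pzero xs
  | ev_succ xs => Psucc xs
  | ev_proj i xs => Pproj i xs
  | ev_comp _ _ _ _ _ evs ev => Pcomp (revals_nested_ind evs) (reval_nested_ind ev)
  | ev_prec0 _ g _ _ ev => Pprec0 g (reval_nested_ind ev)
  | ev_precS _ _ _ _ _ _ evz ev => PprecS (reval_nested_ind evz) (reval_nested_ind ev)
  | ev_min _ _ _ ev0 evlt => Pmin (reval_nested_ind ev0) (fun z lt_zy =>
      let: ex_intro2 v evz vN0 := evlt z lt_zy in ex_intro2 _ _ v (reval_nested_ind evz) vN0)
  end
with revals_nested_ind gs xs ys (evs : revals gs xs ys) : Q gs xs ys :=
  match evs with
  | evs_nil xs => Qnil xs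
  | evs_cons _ _ _ _ _ ev evs => Qcons (reval_nested_ind ev) (revals_nested_ind evs)
  end.

End RevalInduction.

Lemma reval_fun f xs y y' : reval f xs y -> reval f xs y' -> y = y'.
Proof.
move=> ev; move: f xs y ev y'.
apply: (@reval_nested_ind (fun f xs y => forall y', reval f xs y' -> y = y')
  (fun gs xs ys => forall ys', revals gs xs ys' -> ys = ys')).
- by move=> xs y' H; inversion H.
- by move=> xs y' H; inversion H.
- by move=> i xs y' H; inversion H.
- move=> f gs xs ys y IHs IH y' H; inversion H; subst.
  by match goal with Hs : revals _ _ _ |- _ => apply: IH; rewrite (IHs _ Hs) end.
- by move=> f g xs y IH y' H; inversion H; subst; apply: IH.
- move=> f g n xs z y IHz IHy y' H; inversion H; subst.
  by match goal with Hz : reval (RPrec _ _) (n :: _) _ |- _ =>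
    apply: IHy; rewrite (IHz _ Hz) end.
- move=> f xs y IH0 IHlt y' H; inversion H; subst.
  (* Of two distinct candidates for the least zero, the smaller would be a zero for one derivation
     and a nonzero value for the other. *)
  case: (ltngtP y y') => // lt_yy'.
    match goal with Hlt : forall z, is_true (z < y')%N -> _ |- _ =>
      by have [v Hv []] := Hlt _ lt_yy'; rewrite (IH0 _ Hv) end.
  have [v Hv []] := IHlt _ lt_yy'.
  by match goal with H0 : reval f _ 0%N |- _ => rewrite (Hv _ H0) end.
- by move=> xs ys' H; inversion H.
- move=> g gs xs y ys IHy IHs ys' H; inversion H; subst.
  by match goal with Hz : reval _ _ _, Hs : revals _ _ _ |- _ =>
    rewrite (IHy _ Hz) (IHs _ Hs) end.
Qed.

(** * Numbering of strings and arithmetic of recursive functions *)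

Section StringCodes.
Variable A : finType.

(** Once the successor is removed, division by [#|A|] gives the rank of the head as remainder and
    the code of the tail as quotient. *)
Lemma str_code_inj : injective (@str_code A).
Proof.
elim=> [|a s IHs] [|b t] //= eq_st.
have [lta ltb] := (ltn_ord (enum_rank a), ltn_ord (enum_rank b)).
have eq_st' : (str_code s * #|A| + enum_rank a = str_code t * #|A| + enum_rank b)%N.
  by move: eq_st; rewrite !addSn ![(str_code _ * _)%N]mulnC => -[]; rewrite addnC => ->; rewrite addnC.
have := congr1 (fun n => n %% #|A|)%N eq_st'.
rewrite !modnMDl !modn_small // => eq_ab.
have := congr1 (fun n => n %/ #|A|)%N eq_st'.
have A_gt0 : (0 < #|A|)%N by apply: leq_ltn_trans lta.
rewrite !divnMDl // !divn_small // !addn0 => /IHs ->.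
by congr (_ :: _); apply/enum_rank_inj/val_inj.
Qed.

Lemma str_code_surj (a0 : A) n : exists s : seq A, str_code s = n.
Proof.
have A_gt0 : (0 < #|A|)%N by apply/card_gt0P; exists a0.
elim/ltn_ind: n => -[|n] IHn; first by exists [::].
have [|s sE] := IHn (n %/ #|A|)%N; first by rewrite ltnS leq_div.
exists (enum_val (Ordinal (ltn_pmod n A_gt0)) :: s) => /=.
by rewrite enum_valK /= sE addSn mulnC addnC -divn_eq.
Qed.

End StringCodes.

Definition rec_pred := RPrec RZero (RProj 0).
Definition rec_sub := RPrec (RProj 0) (RComp rec_pred [:: RProj 1]).
Definition rec_add := RPrec (RProj 0) (RComp RSucc [:: RProj 1]).
(** The sum of the two truncated differences is the distance of the values; it vanishes exactly when
    they agree, so [RMin] can use it as an equality test. *)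
Definition rec_dist f g :=
  RComp rec_add [:: RComp rec_sub [:: f; g]; RComp rec_sub [:: g; f]].

Lemma reval_comp1 f g xs y z :
  reval g xs y -> reval f [:: y] z -> reval (RComp f [:: g]) xs z.
Proof. by move=> gy fz; apply: ev_comp fz; do !constructor. Qed.

Lemma reval_comp2 f g h xs y z v : reval g xs y -> reval h xs z ->
  reval f [:: y; z] v -> reval (RComp f [:: g; h]) xs v.
Proof. by move=> gy hz fv; apply: ev_comp fv; do !constructor. Qed.

Lemma reval_pred n xs : reval rec_pred (n :: xs) n.-1.
Proof.
elim: n => [|n IHn]; first by do !constructor.
exact: ev_precS IHn (ev_proj 0 _).
Qed.

Lemma reval_sub m n : reval rec_sub [:: m; n] (n - m)%N.
Proof.
elim: m => [|m IHm]; first by rewrite subn0; constructor; exact: ev_proj.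
apply: ev_precS IHm _; rewrite subnS.
exact: reval_comp1 (ev_proj 1 _) (reval_pred _ _).
Qed.

Lemma reval_add m n : reval rec_add [:: m; n] (m + n)%N.
Proof.
elim: m => [|m IHm]; first by constructor; exact: ev_proj.
by apply: ev_precS IHm _; apply: reval_comp1 (ev_proj 1 _) (ev_succ _).
Qed.

Lemma reval_dist f g xs m n : reval f xs m -> reval g xs n ->
  reval (rec_dist f g) xs ((n - m) + (m - n))%N.
Proof.
by move=> fm gn; apply: reval_comp2 (reval_add _ _);
  apply: reval_comp2 (reval_sub _ _).
Qed.

(** * Decoding a compression algorithm by unbounded search *)

Section Decoder.
Variables (A : finType) (a0 : A) (Z : seq A -> seq bool).

(** The partial inverse of [Z] is first chosen classically; that it is computable is proved
    separately by exhibiting a program. *)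
Definition decoder (p : seq bool) : option (seq A) :=
  if pselect (exists s, Z s = p) is left ex then Some (projT1 (cid ex)) else None.

Hypothesis injZ : injective Z.

Lemma decoderP p s : decoder p = Some s <-> Z s = p.
Proof.
rewrite /decoder; case: pselect => [ex|nex]; last first.
  by split=> // Zs; case: nex; exists s.
case: (cid ex) => t /= Zt; split=> [[<-] //|Zs].
by congr Some; apply: injZ; rewrite Zt.
Qed.

(** The program searches for the least [z] such that the string coded by [z] is compressed to [p].
    As [Z] is total and every natural number is a code, each test before the solution terminates; by
    injectivity of [Z] none of them succeeds too early. *)
Lemma decoder_partial_recursive : total_recursive Z -> partial_recursive decoder.
Proof.
move=> [e eZ].
exists (RMin (rec_dist (RComp e [:: RProj 0]) (RProj 1))) => p s.
have ev_at (t : seq A) : reval (rec_dist (RComp e [:: RProj 0]) (RProj 1))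
    [:: str_code t; str_code p]
    ((str_code p - str_code (Z t)) + (str_code (Z t) - str_code p))%N.
  apply: reval_dist; last exact: (ev_proj 1).
  by apply: (@reval_comp1 _ _ _ (str_code t)) (eZ t); exact: ev_proj.
rewrite decoderP; split=> [Zs|Hs].
  apply: ev_min; first by have := ev_at s; rewrite Zs subnn.
  move=> z lt_z; have [t tE] := str_code_surj a0 z.
  rewrite -tE; eexists; first exact: ev_at.
  move=> dist0; have /str_code_inj Zt : str_code (Z t) = str_code p by lia.
  by move: lt_z; rewrite -tE -(injZ (etrans Zt (esym Zs))) ltnn.
inversion Hs; subst.
match goal with H0 : reval _ _ 0%N |- _ => have dist0 := reval_fun H0 (ev_at s) end.
by apply: str_code_inj; lia.
Qed.

End Decoder.

(** * Algorithmic information content *)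

Section Complexity.
Variables (R : realType) (A : finType) (a0 : A).
Variables (U : seq bool -> option (seq A)) (Z : seq A -> seq bool).
Hypotheses (hU : universal U) (hZ : compression_algorithm Z).

Lemma universal_compression :
  exists c : nat, forall s, exists2 q, U q = Some s & (size q <= size (Z s) + c)%N.
Proof.
have [[_ optU] [recZ injZ]] := (hU, hZ).
have [c cP] := optU _ (decoder_partial_recursive a0 injZ recZ).
by exists c => s; apply: cP; apply/decoderP.
Qed.

(** Every string has a program, namely one simulating the decoder on its compressed form, so the
    infimum is a minimum over a nonempty set of natural numbers. The rest of the proof works with
    [K]. *)
Lemma I_AIC_nat : exists (K : seq A -> nat),
  [/\ forall s, I_AIC R U s = (K s)%:R%:E,
      exists c, forall s, (K s <= size (Z s) + c)%N &
      forall s, exists2 q, U q = Some s & size q = K s].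
Proof.
have [c cP] := universal_compression.
pose P s := fun m => `[< exists2 q, U q = Some s & size q = m >].
have exP s : exists m, P s m.
  by have [q Uq _] := cP s; exists (size q); apply/asboolP; exists q.
exists (fun s => ex_minn (exP s)); split=> [s||s].
- case: ex_minnP => m /asboolP[q Uq sq] minm; apply/eqP; rewrite eq_le.
  apply/andP; split.
    by apply: ereal_inf_lbound; exists q => //=; rewrite sq.
  apply: le_ereal_inf_tmp => _ [p /= Up <-]; rewrite lee_fin ler_nat.
  by apply: minm; apply/asboolP; exists p.
- exists c => s; case: ex_minnP => m _ minm; have [q Uq le_q] := cP s.
  by apply: leq_trans le_q; apply: minm; apply/asboolP; exists q.
- by case: ex_minnP => m /asboolP.
Qed.

End Complexity.

(** A shortest program determines its output, so choosing one embeds the level of complexity [m]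
    into the [2 ^ m] binary words of length [m]. *)
Lemma card_complexity_level (A : finType) (U : seq bool -> option (seq A))
    (K : seq A -> nat) (T : finType) (enc : T -> seq A) (m : nat) :
  injective enc -> (forall s, exists2 q, U q = Some s & size q = K s) ->
  (#|[set t | K (enc t) == m]%SET| <= 2 ^ m)%N.
Proof.
move=> injenc KP.
have tagP t : exists q : m.-tuple bool, K (enc t) = m -> U q = Some (enc t).
  have [q Uq sq] := KP (enc t); case: (eqVneq (size q) m) => [sqm|/eqP sqm].
    by exists (Tuple (introT eqP sqm)).
  (* Off the level any tuple will do; the constant one is a default that makes [prog] total. *)
  by exists (nseq_tuple m true) => Km; case: sqm; rewrite sq.
pose prog t := projT1 (cid (tagP t)).
have progP t : K (enc t) = m -> U (prog t) = Some (enc t).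
  by rewrite /prog; case: (cid _).
rewrite -card_bool -card_tuple -[X in (_ <= X)%N]cardsT.
rewrite -(@card_in_imset _ _ prog); first by apply/subset_leq_card; rewrite finset.subsetT.
move=> t u; rewrite !inE => /eqP Kt /eqP Ku eq_prog; apply: injenc.
by have := progP _ Kt; rewrite eq_prog (progP _ Ku) => -[].
Qed.

(** * Entropy of finite distributions *)

Section Log2.
Variable R : realType.
Implicit Types x y p q : R.

Lemma ln2_gt0 : 0 < ln 2 :> R.
Proof. by apply: ln_gt0; rewrite ltr1n. Qed.

Lemma xlogxE p : xlogx p = p * log2 p.
Proof. by rewrite /xlogx; case: eqP => // ->; rewrite mul0r. Qed.

Lemma log2M x y : 0 < x -> 0 < y -> log2 (x * y) = log2 x + log2 y.
Proof. by move=> x0 y0; rewrite /log2 lnM ?posrE// mulrDl. Qed.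

Lemma log2V x : 0 < x -> log2 x^-1 = - log2 x.
Proof. by move=> x0; rewrite /log2 lnV ?posrE// mulNr. Qed.

Lemma log2_pow2 n : log2 (2 ^+ n) = n%:R :> R.
Proof.
by rewrite /log2 lnXn ?ltr0n// -[ln 2 *+ n]mulr_natl mulfK// gt_eqF// ln2_gt0.
Qed.

Lemma log2_1 : log2 1 = 0 :> R.
Proof. by rewrite /log2 ln1 mul0r. Qed.

Lemma le_log2 x y : 0 < x -> x <= y -> log2 x <= log2 y.
Proof.
move=> x0 xy; rewrite /log2 ler_pM2r ?invr_gt0 ?ln2_gt0//.
by rewrite ler_ln ?posrE// (lt_le_trans x0).
Qed.

Lemma log2_le0 x : x <= 1 -> log2 x <= 0.
Proof. by move=> x1; apply: mulr_le0_ge0; [exact: ln_le0|rewrite invr_ge0; exact: ltW ln2_gt0]. Qed.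

Lemma log2_prod n (F : 'I_n -> R) : (forall i, 0 < F i) ->
  log2 (\prod_i F i) = \sum_i log2 (F i).
Proof.
move=> F0; elim: n F F0 => [|n IHn] F F0; first by rewrite !big_ord0 log2_1.
by rewrite !big_ord_recl log2M ?IHn// prodr_gt0.
Qed.

Lemma ln_le_sub1 x : 0 < x -> ln x <= x - 1.
Proof. by move=> x0; rewrite -{1}[x](addrNK 1) addrC le_ln1Dx//; lra. Qed.

Lemma gibbs_term p q : 0 <= p -> 0 <= q -> (0 < p -> 0 < q) ->
  p * log2 q - xlogx p <= (q - p) / ln 2.
Proof.
move=> p0 q0 pq; rewrite xlogxE /log2 !mulrA -mulrBl ler_pM2r ?invr_gt0 ?ln2_gt0//.
have [->|pN0] := eqVneq p 0; first by rewrite !mul0r !subr0.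
have p_gt0 : 0 < p by rewrite lt_neqAle eq_sym pN0.
have q_gt0 := pq p_gt0.
rewrite -mulrBr -ln_div ?posrE//.
apply: (@le_trans _ _ (p * (q / p - 1))).
  by rewrite ler_wpM2l// ln_le_sub1// divr_gt0.
by rewrite mulrBr mulr1 mulrCA divff// mulr1.
Qed.

Definition shannon (T : finType) (p : T -> R) : R := - \sum_a xlogx (p a).

(** Summing [gibbs_term], which is [ln x <= x - 1] at [x = q / p]. Comparing total masses by an
    inequality lets sub-probabilities such as Kraft weights and channel outputs serve as [q]. *)
Lemma gibbs (T : finType) (p q : T -> R) :
  (forall a, 0 <= p a) -> (forall a, 0 <= q a) -> (forall a, 0 < p a -> 0 < q a) ->
  \sum_a q a <= \sum_a p a -> shannon p <= - \sum_a p a * log2 (q a).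
Proof.
move=> p0 q0 pq le_qp; rewrite /shannon lerN2 -subr_le0 -sumrB.
apply: (@le_trans _ _ (\sum_a (q a - p a) / ln 2)).
  by apply: ler_sum => a _; apply: gibbs_term; auto.
rewrite -mulr_suml sumrB; apply: mulr_le0_ge0; first by rewrite subr_le0.
by rewrite invr_ge0; exact: ltW (ln2_gt0).
Qed.

Lemma shannon_ge0 (T : finType) (p : T -> R) :
  (forall a, 0 <= p a <= 1) -> 0 <= shannon p.
Proof.
move=> p01; rewrite oppr_ge0; apply: sumr_le0 => a _.
by have /andP[p0 p1] := p01 a; rewrite xlogxE mulr_ge0_le0// log2_le0.
Qed.

(** With [s] the square root of [p], one has [- ln p = 2 * ln s^-1 <= 2 * (s^-1 - 1)]. The bound
    gives the continuity of [xlogx] at 0, where the logarithm has none. *)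
Lemma xlogx_sqrt p : 0 <= p <= 1 -> `|xlogx p| <= 2 / ln 2 * Num.sqrt p.
Proof.
move=> /andP[p0 p1]; have [->|pN0] := eqVneq p 0.
  by rewrite sqrtr0 mulr0 /xlogx eqxx normr0.
have p_gt0 : 0 < p by rewrite lt_neqAle eq_sym pN0.
have s_gt0 : 0 < Num.sqrt p by rewrite sqrtr_gt0.
have -> : `|xlogx p| = p * - ln p / ln 2.
  rewrite xlogxE ler0_norm; first by rewrite /log2 mulrN mulNr mulrA.
  by apply: mulr_ge0_le0 => //; exact: log2_le0.
rewrite [leRHS]mulrAC ler_pM2r ?invr_gt0 ?ln2_gt0//.
set s := Num.sqrt p in s_gt0 *; have pE : p = s * s by rewrite -expr2 sqr_sqrtr.
have lnpE : ln p = ln s + ln s by rewrite pE lnM ?posrE.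
have : ln s^-1 <= s^-1 - 1 by rewrite ln_le_sub1// invr_gt0.
rewrite lnV ?posrE// lnpE [X in X * _]pE; set l := ln s => le_l.
have le_sl : s * - l <= 1 - s.
  apply: (@le_trans _ _ (s * (s^-1 - 1))); first by rewrite ler_wpM2l// ltW.
  by rewrite mulrBr divff ?gt_eqF// mulr1.
have : s * (s * - l) <= s * (1 - s) by rewrite ler_wpM2l// ltW.
have : 0 <= s * s by rewrite mulr_ge0// ltW.
by move=> ss0 sl; nra.
Qed.

Lemma cvg_xlogx (u : nat -> R) p : (forall n, 0 <= u n <= 1) ->
  u @ \oo --> p -> (@xlogx R \o u) @ \oo --> xlogx p.
Proof.
move=> u01 up.
have p0 : 0 <= p.
  by apply: (cvgr_to_ge up); apply: nearW => n; have /andP[] := u01 n.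
have [p_0|pN0] := eqVneq p 0; last first.
  have p_gt0 : 0 < p by rewrite lt_neqAle eq_sym pN0.
  have -> : @xlogx R \o u = (fun n => u n * (ln (u n) / ln 2)).
    by apply/funext => n /=; rewrite xlogxE.
  rewrite xlogxE /log2; apply: (cvgM up); apply: cvgMr_tmp.
  exact: (cvg_comp _ _ up (continuous_ln p_gt0)).
rewrite p_0 in up *; have -> : xlogx 0 = 0 :> R by rewrite /xlogx eqxx.
have sqrt_cvg0 : 2 / ln 2 * Num.sqrt (u n) @[n --> \oo] --> (0 : R).
  have -> : 0 = 2 / ln 2 * Num.sqrt 0 :> R by rewrite sqrtr0 mulr0.
  by apply: cvgMl_tmp; exact: (cvg_comp _ _ up (@sqrt_continuous R 0)).
apply: (@squeeze_cvgr _ _ _ _ (fun n => - (2 / ln 2 * Num.sqrt (u n)))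
    (fun n => 2 / ln 2 * Num.sqrt (u n))) => //.
- by apply: nearW => n; rewrite -ler_norml; exact: (xlogx_sqrt (u01 n)).
- by rewrite -oppr0; exact: cvgN.
Qed.

End Log2.

(** * Subadditive sequences *)

Section Fekete.
Variables (R : realType) (u : nat -> R).
Hypotheses (u_ge0 : forall n, 0 <= u n) (u_sub : forall m n, u (m + n)%N <= u m + u n).

Lemma subadditive_mul q m r : u (q * m + r)%N <= q%:R * u m + u r.
Proof.
elim: q => [|q IHq]; first by rewrite !mul0r add0r mul0n.
rewrite mulSn -addnA; apply: le_trans (u_sub _ _) _.
by rewrite -natr1 mulrDl mul1r; lra.
Qed.

(** The limit is the infimum of the ratios, which gives both conclusions: a ratio at [m] close to
    the infimum controls all large [n] after Euclidean division of [n] by [m]. *)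
Lemma fekete : exists l, u n / n%:R @[n --> \oo] --> l /\
  forall n, (0 < n)%N -> l <= u n / n%:R.
Proof.
pose S := [set u n / n%:R | n in [set n | (0 < n)%N]].
have infS : has_inf S.
  split; first by exists (u 1%N / 1), 1%N.
  by exists 0 => _ [n _ <-]; rewrite divr_ge0.
have lbS n : (0 < n)%N -> inf S <= u n / n%:R.
  by move=> n0; apply: (ge_inf infS.2); exists n.
exists (inf S); split=> //; apply/cvgrPdist_le => e e0.
have e20 : 0 < e / 2 by rewrite divr_gt0.
have [_ [m /= m0 <-] lt_m] := inf_adherent e20 infS.
(* [C] dominates [u r] for every remainder [r] modulo [m], whatever [n] is. *)
pose C := \sum_(r < m) u r.
have C0 : 0 <= C by apply: sumr_ge0.
near=> n.
have n0 : (0 < n)%N by near: n; exact: nbhs_infty_gt.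
have n0' : 0 < n%:R :> R by rewrite ltr0n.
have Cn : C / n%:R <= e / 2.
  rewrite ler_pdivrMr// mulrC -ler_pdivrMr//.
  by near: n; exact: nbhs_infty_ger.
rewrite distrC ger0_norm ?subr_ge0 ?lbS//.
suff : u n / n%:R <= u m / m%:R + C / n%:R by lra.
rewrite ler_pdivrMr// mulrDl divfK ?gt_eqF//.
rewrite {1}(divn_eq n m); apply: le_trans (subadditive_mul _ _ _) _.
apply: lerD; last first.
  rewrite /C (bigD1 (Ordinal (ltn_pmod n m0)))//= lerDl.
  by apply: sumr_ge0.
rewrite mulrC -mulrA ler_wpM2l// mulrC ler_pdivlMr ?ltr0n//.
by rewrite -natrM ler_nat leq_trunc_div.
Unshelve. all: by end_near. Qed.

End Fekete.

(** * Finitely valued random variables and stationary processes *)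

Section FiniteValued.
Context d (T : measurableType d) (R : realType) (P : probability T R).

Definition Pr (B : set T) : R := fine (P B).

Lemma PrE B : measurable B -> P B = (Pr B)%:E.
Proof. by move=> mB; rewrite /Pr fineK// fin_num_measure. Qed.

Lemma Pr_ge0 B : 0 <= Pr B.
Proof. by rewrite /Pr fine_ge0. Qed.

Lemma Pr_setT : Pr setT = 1.
Proof. by rewrite /Pr probability_setT. Qed.

Lemma Pr_set0 : Pr set0 = 0.
Proof. by rewrite /Pr measure0. Qed.

Lemma Pr_le1 B : measurable B -> Pr B <= 1.
Proof. by move=> mB; rewrite -lee_fin -PrE// probability_le1. Qed.

Lemma le_Pr B C : measurable B -> measurable C -> B `<=` C -> Pr B <= Pr C.
Proof. by move=> mB mC BC; rewrite -lee_fin -!PrE// le_measure// inE. Qed.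

Lemma PrC B : measurable B -> Pr (~` B) = 1 - Pr B.
Proof.
move=> mB; apply: EFin_inj.
by rewrite -PrE ?probability_setC ?PrE//; exact: measurableC.
Qed.

Definition finitely_valued (I : finType) (X : T -> I) :=
  forall i, measurable (X @^-1` [set i]).

Definition law (I : finType) (X : T -> I) (i : I) : R := Pr (X @^-1` [set i]).

Definition entropy (I : finType) (X : T -> I) : R := shannon (law X).

Lemma measurable_event (I : finType) (X : T -> I) (Q : pred I) :
  finitely_valued X -> measurable [set w | Q (X w)].
Proof.
move=> mX; have -> : [set w | Q (X w)] = \bigcup_(i in [set i | Q i]) (X @^-1` [set i]).
  by apply/seteqP; split=> [w Qw|w [i Qi /= Xw]] /=; [exists (X w)|rewrite Xw].
by apply: fin_bigcup_measurable => // i _; exact: mX.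
Qed.

Lemma Pr_event (I : finType) (X : T -> I) (Q : pred I) :
  finitely_valued X -> Pr [set w | Q (X w)] = \sum_(i | Q i) law X i.
Proof.
move=> mX; apply: EFin_inj; rewrite -PrE; last exact: measurable_event.
pose F i := if Q i then X @^-1` [set i] else set0.
have mF i : measurable (F i) by rewrite /F; case: ifP.
have -> : [set w | Q (X w)] = \bigcup_(i in [set: I]) F i.
  apply/seteqP; split=> [w /= Qw|w [i _]]; first by exists (X w); rewrite // /F Qw.
  by rewrite /F; case: ifP => // Qi /= ->.
rewrite measure_fin_bigcup//.
  rewrite (_ : [set: I] = [set` index_enum I]); last first.
    by apply/seteqP; split=> i //= _; rewrite mem_index_enum.
  rewrite -fsbig_seq ?index_enum_uniq// -sumEFin [in RHS]big_mkcond/=; apply: eq_bigr => i _.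
  by rewrite /F; case: ifP => // _; rewrite PrE// mX.
- exact: finite_finset.
have FX i w : F i w -> X w = i by rewrite /F; case: ifP.
by move=> i j _ _ [w [/FX Xi /FX Xj]]; rewrite -Xi.
Qed.

Lemma law_ge0 (I : finType) (X : T -> I) i : 0 <= law X i.
Proof. exact: Pr_ge0. Qed.

Lemma law_le1 (I : finType) (X : T -> I) i : finitely_valued X -> law X i <= 1.
Proof. by move=> mX; apply: Pr_le1. Qed.

Lemma law_sum (I : finType) (X : T -> I) : finitely_valued X -> \sum_i law X i = 1.
Proof.
by move=> mX; rewrite -(Pr_event xpredT)// -Pr_setT; congr Pr; apply/seteqP; split.
Qed.

Lemma law_attained (I : finType) (X : T -> I) i : 0 < law X i -> exists w, X w = i.
Proof.
move=> law_gt0; apply: contrapT => nex; move: law_gt0; rewrite /law.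
suff -> : X @^-1` [set i] = set0 by rewrite Pr_set0 ltxx.
by rewrite -subset0 => w Xw; apply: nex; exists w.
Qed.

Lemma finitely_valued_comp (I J : finType) (X : T -> I) (f : I -> J) :
  finitely_valued X -> finitely_valued (f \o X).
Proof.
move=> mX j; rewrite (_ : _ @^-1` _ = [set w | (f (X w)) == j]).
  exact: (@measurable_event _ _ (fun i => f i == j)).
by apply/seteqP; split=> w /eqP.
Qed.

Lemma law_comp (I J : finType) (X : T -> I) (f : I -> J) j :
  finitely_valued X -> law (f \o X) j = \sum_(i | f i == j) law X i.
Proof.
move=> mX; rewrite -(Pr_event (fun i => f i == j))//; congr Pr.
by apply/seteqP; split=> w /eqP.
Qed.

Lemma law_comp_expectation (I J : finType) (X : T -> I) (f : I -> J) (g : J -> R) :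
  finitely_valued X -> \sum_j law (f \o X) j * g j = \sum_i law X i * g (f i).
Proof.
move=> mX; rewrite [RHS](partition_big f xpredT)//=; apply: eq_bigr => j _.
by rewrite law_comp// mulr_suml; apply: eq_bigr => i /eqP ->.
Qed.

Lemma le_expectation (I : finType) (X : T -> I) (g : I -> R) c :
  finitely_valued X -> (forall w, c <= g (X w)) -> c <= \sum_i law X i * g i.
Proof.
move=> mX le_g; rewrite -[c]mul1r -(law_sum mX) mulr_suml; apply: ler_sum => i _.
have [law0|/negP law0] := boolP (0 < law X i).
  by rewrite ler_pM2l//; have [w <-] := law_attained law0.
suff -> : law X i = 0 by rewrite !mul0r.
by apply/eqP; rewrite eq_le law_ge0 leNgt andbT; apply/negP.
Qed.

Lemma finitely_valued_pair (I J : finType) (X : T -> I) (Y : T -> J) :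
  finitely_valued X -> finitely_valued Y -> finitely_valued (fun w => (X w, Y w)).
Proof.
move=> mX mY [i j]; rewrite (_ : _ @^-1` _ = X @^-1` [set i] `&` Y @^-1` [set j]).
  exact: measurableI.
by apply/seteqP; split=> w /= [-> ->].
Qed.

Lemma entropy_ge0 (I : finType) (X : T -> I) : finitely_valued X -> 0 <= entropy X.
Proof. by move=> mX; apply: shannon_ge0 => i; rewrite law_ge0 law_le1. Qed.

(** Each fibre of [X] lies in a fibre of [f \o X], which has at least its probability; the
    logarithms compare term by term. *)
Lemma entropy_comp_le (I J : finType) (X : T -> I) (f : I -> J) :
  finitely_valued X -> entropy (f \o X) <= entropy X.
Proof.
move=> mX; rewrite /entropy /shannon lerN2.
have -> : \sum_j xlogx (law (f \o X) j) = \sum_i law X i * log2 (law (f \o X) (f i)).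
  rewrite -(law_comp_expectation f (fun j => log2 (law (f \o X) j)))//.
  by apply: eq_bigr => j _; rewrite xlogxE.
apply: ler_sum => i _; rewrite xlogxE.
have [law0|/negP law0] := boolP (0 < law X i); last first.
  suff -> : law X i = 0 by rewrite !mul0r.
  by apply/eqP; rewrite eq_le law_ge0 leNgt andbT; apply/negP.
rewrite ler_pM2l//; apply: le_log2 => //; rewrite law_comp//.
by rewrite (bigD1 i)//= lerDl; apply: sumr_ge0 => k _; exact: law_ge0.
Qed.

(** Gibbs' inequality against the product of the two marginal laws. *)
Lemma entropy_pair_le (I J : finType) (X : T -> I) (Y : T -> J) :
  finitely_valued X -> finitely_valued Y ->
  entropy (fun w => (X w, Y w)) <= entropy X + entropy Y.
Proof.
move=> mX mY; set W := fun w => (X w, Y w).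
have mW : finitely_valued W by exact: finitely_valued_pair.
have lawX p : law W p <= law X p.1.
  by apply: le_Pr => // w /= <-.
have lawY p : law W p <= law Y p.2.
  by apply: le_Pr => // w /= <-.
apply: le_trans (gibbs (q := fun p => law X p.1 * law Y p.2) _ _ _ _) _.
- by move=> p; exact: law_ge0.
- by move=> p; rewrite mulr_ge0// law_ge0.
- by move=> p p0; rewrite mulr_gt0// (lt_le_trans p0).
- rewrite law_sum// -(pair_bigA _ (fun i j => law X i * law Y j))/=.
  under eq_bigr do rewrite -mulr_sumr law_sum// mulr1.
  by rewrite law_sum.
have -> : \sum_p law W p * log2 (law X p.1 * law Y p.2) =
    \sum_p (law W p * log2 (law X p.1) + law W p * log2 (law Y p.2)).
  apply: eq_bigr => p _.
  have [law0|/negP law0] := boolP (0 < law W p); last first.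
    suff -> : law W p = 0 by rewrite !mul0r addr0.
    by apply/eqP; rewrite eq_le law_ge0 leNgt andbT; apply/negP.
  by rewrite log2M ?mulrDr// (lt_le_trans law0).
rewrite big_split/= -(law_comp_expectation fst (fun i => log2 (law X i)))//.
rewrite -(law_comp_expectation snd (fun i => log2 (law Y i)))// opprD.
rewrite /entropy /shannon; apply: lerD; rewrite lerN2; apply: ler_sum => i _.
  by rewrite xlogxE.
by rewrite xlogxE.
Qed.

End FiniteValued.

(** * Stationary processes and their entropy rate *)

Section Process.
Context d (T : measurableType d) (R : realType) (P : probability T R).
Variable phi : T -> T.
Hypotheses (mphi : measurable_fun setT phi)
  (phi_inv : forall B, measurable B -> P (phi @^-1` B) = P B).

Lemma measurable_preimage_iter k B :
  measurable B -> measurable (iter k phi @^-1` B).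
Proof.
elim: k B => [|k IHk] B mB //.
rewrite (_ : _ @^-1` _ = iter k phi @^-1` (phi @^-1` B))//.
by apply: IHk; rewrite -[_ @^-1` _]setTI; exact: mphi.
Qed.

Lemma Pr_preimage_iter k B : measurable B -> Pr P (iter k phi @^-1` B) = Pr P B.
Proof.
elim: k B => [|k IHk] B mB //.
rewrite (_ : _ @^-1` _ = iter k phi @^-1` (phi @^-1` B))//.
rewrite IHk; first by rewrite /Pr phi_inv.
exact: (measurable_preimage_iter 1).
Qed.

Section OneVariable.
Variables (I : finType) (X : T -> I).
Hypothesis mX : finitely_valued X.

Lemma finitely_valued_iter k : finitely_valued (X \o iter k phi).
Proof. by move=> i; apply: (measurable_preimage_iter k (mX i)). Qed.

Lemma law_iter k : law P (X \o iter k phi) = law P X.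
Proof. by apply/funext => i; apply: (Pr_preimage_iter k (mX i)). Qed.

Definition proc n (w : T) : n.-tuple I := [tuple X (iter k phi w) | k < n].

Lemma finitely_valued_proc n : finitely_valued (proc n).
Proof.
move=> t; rewrite (_ : _ @^-1` _ =
    \bigcap_(k in [set: 'I_n]) ((X \o iter k phi) @^-1` [set tnth t k])).
  by apply: fin_bigcap_measurable => // k _; exact: finitely_valued_iter.
apply/seteqP; split=> [w /= <- k _ /=|w tw /=]; first by rewrite tnth_mktuple.
by apply: eq_from_tnth => k; rewrite tnth_mktuple; exact: tw.
Qed.

Lemma expectation_proc n (g : I -> R) :
  \sum_t law P (proc n) t * (\sum_k g (tnth t k)) = n%:R * \sum_i law P X i * g i.
Proof.
under eq_bigr do rewrite mulr_sumr.
rewrite exchange_big/= -[n in RHS]card_ord mulr_natl -sumr_const; apply: eq_bigr => k _.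
rewrite -(law_comp_expectation P (fun t => tnth t k))//; last exact: finitely_valued_proc.
rewrite -(law_iter k); apply: eq_bigr => i _; congr (law _ _ _ * _).
by apply/funext => w /=; rewrite tnth_mktuple.
Qed.

Lemma entropy_iter k : entropy P (X \o iter k phi) = entropy P X.
Proof. by rewrite /entropy law_iter. Qed.

End OneVariable.

(** The long block is a function of its first [m] entries paired with the block of length [n] seen
    after [m] steps, and the latter has the law of [proc X n] by stationarity. *)
Lemma entropy_proc_subadditive (I : finType) (X : T -> I) m n : finitely_valued X ->
  entropy P (proc X (m + n)) <= entropy P (proc X m) + entropy P (proc X n).
Proof.
move=> mX; pose glue (p : m.-tuple I * n.-tuple I) : (m + n).-tuple I :=
  [tuple match fintype.split k with inl i => tnth p.1 i | inr j => tnth p.2 j end | k < m + n].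
pose W w := (proc X m w, (proc X n \o iter m phi) w).
have mm : finitely_valued (proc X m) by exact: finitely_valued_proc.
have mn : finitely_valued (proc X n) by exact: finitely_valued_proc.
have mnm : finitely_valued (proc X n \o iter m phi) by exact: finitely_valued_iter.
have mW : finitely_valued W by exact: finitely_valued_pair.
have -> : proc X (m + n) = glue \o W.
  apply/funext => w /=; apply: eq_from_tnth => k; rewrite !tnth_mktuple.
  by case: fintype.splitP => i ->; rewrite tnth_mktuple// addnC iterD.
apply: le_trans (entropy_comp_le P glue mW) _.
by apply: le_trans (entropy_pair_le P mm mnm) _; rewrite entropy_iter.
Qed.

Definition entropy_rate (I : finType) (X : T -> I) : R :=
  limn (fun n => entropy P (proc X n) / n%:R).

Lemma entropy_rateP (I : finType) (X : T -> I) : finitely_valued X ->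
  entropy P (proc X n) / n%:R @[n --> \oo] --> entropy_rate X /\
  forall n, (0 < n)%N -> entropy_rate X <= entropy P (proc X n) / n%:R.
Proof.
move=> mX; have [||l [cvg_l le_l]] := @fekete R (fun n => entropy P (proc X n)).
- by move=> n; apply: entropy_ge0; exact: finitely_valued_proc.
- by move=> m n; exact: entropy_proc_subadditive.
by have -> : entropy_rate X = l by apply/cvg_lim.
Qed.

End Process.

(** * The ergodic theorem for visit frequencies *)

Section Birkhoff.
Context d (T : measurableType d) (R : realType) (P : probability T R).
Variable phi : T -> T.
Hypotheses (mphi : measurable_fun setT phi)
  (phi_inv : forall B, measurable B -> P (phi @^-1` B) = P B)
  (phi_erg : forall B, measurable B -> phi @^-1` B = B -> P B = 0%E \/ P B = 1%E).

Definition visits (X : T -> bool) n w : nat := (\sum_(i < n) X (iter i phi w))%N.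

Lemma visitsD X m n w : visits X (m + n) w = (visits X m w + visits X n (iter m phi w))%N.
Proof.
rewrite /visits big_split_ord/=; congr addn.
by apply: eq_bigr => i _; rewrite addnC iterD.
Qed.

Lemma visits1 X w : visits X 1 w = X w.
Proof. by rewrite /visits big_ord1. Qed.

Lemma visitsS X n w : visits X n.+1 w = (X w + visits X n (phi w))%N.
Proof. by rewrite -add1n visitsD visits1. Qed.

Lemma visits_proc X n w : visits X n w = (\sum_k tnth (proc phi X n w) k)%N.
Proof. by apply: eq_bigr => i _; rewrite tnth_mktuple. Qed.

Lemma visits_negb X n w : (visits (negb \o X) n w + visits X n w = n)%N.
Proof.
rewrite /visits -big_split/= -[RHS]card_ord -sum1_card; apply: eq_bigr => i _.
by case: (X _).
Qed.

Lemma measurable_visits X n (Q : pred nat) :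
  finitely_valued X -> measurable [set w | Q (visits X n w)].
Proof.
move=> mX; have := measurable_event (fun t : n.-tuple bool => Q (\sum_k tnth t k)%N)
  (finitely_valued_proc mphi mX (n := n)).
by congr (measurable _); apply/seteqP; split=> w /=; rewrite visits_proc.
Qed.

Lemma Pr_bigcap_cvg (F : nat -> set T) : (forall n, measurable (F n)) ->
  nonincreasing_seq F -> Pr P (F n) @[n --> \oo] --> Pr P (\bigcap_n F n).
Proof.
move=> mF Fdec; have mcap : measurable (\bigcap_n F n) by exact: bigcapT_measurable.
apply: fine_cvg; rewrite fineK ?fin_num_measure//; apply: nonincreasing_cvg_mu => //.
by apply: le_lt_trans (probability_le1 P (mF 0%N)) _; rewrite ltry.
Qed.

Definition often_above X (q : R) : set T :=
  [set w | forall N, exists2 n, (N <= n)%N & q * n%:R <= (visits X n w)%:R].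

Lemma measurable_often_above X q : finitely_valued X -> measurable (often_above X q).
Proof.
move=> mX; rewrite (_ : often_above X q = \bigcap_N \bigcup_(n in [set n | (N <= n)%N])
    [set w | (fun m => q * n%:R <= m%:R) (visits X n w)]).
  apply: bigcapT_measurable => N; apply: bigcup_measurable => n _.
  exact: (@measurable_visits X n (fun m => q * n%:R <= m%:R)).
apply/seteqP; split=> [w Hw N _|w Hw N].
  by have [n Nn qn] := Hw N; exists n.
by have [n Nn qn] := Hw N I; exists n.
Qed.

Lemma often_above_le X q q' : q' <= q -> often_above X q `<=` often_above X q'.
Proof.
move=> qq' w Hw N; have [n Nn qn] := Hw N; exists n => //.
by apply: le_trans qn; rewrite ler_wpM2r.
Qed.

(** Moving the window by one step changes a frequency by a quantity of order [1 / n], which the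
    margin [q - q'] absorbs at late times; [N'] is the time from which it does. *)
Lemma often_above_shift X q q' w : q' < q -> often_above X q (phi w) -> often_above X q' w.
Proof.
move=> qq' Hw N; pose N' := (Num.truncn (q' / (q - q'))).+1.
have [n le_n qn] := Hw (maxn N N'); exists n.+1.
  by apply: leqW; apply: leq_trans le_n; exact: leq_maxl.
have dn : q' <= (q - q') * n%:R.
  rewrite mulrC -ler_pdivrMr ?subr_gt0//; apply: le_trans (ltW (truncnS_gt _)) _.
  by rewrite ler_nat; apply: leq_trans le_n; exact: leq_maxr.
apply: (@le_trans _ _ (visits X n (phi w))%:R); last by rewrite ler_nat visitsS leq_addl.
by apply: le_trans qn; rewrite -natr1; lra.
Qed.

Lemma often_above_unshift X q q' w : q' < q -> often_above X q w -> often_above X q' (phi w).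
Proof.
move=> qq' Hw N; pose N' := (Num.truncn ((1 - q) / (q - q'))).+1.
have [[|n] le_n qn] := Hw (maxn N N').+1; first by [].
rewrite ltnS in le_n; exists n; first by apply: leq_trans le_n; exact: leq_maxl.
have dn : 1 - q <= (q - q') * n%:R.
  rewrite mulrC -ler_pdivrMr ?subr_gt0//; apply: le_trans (ltW (truncnS_gt _)) _.
  by rewrite ler_nat; apply: leq_trans le_n; exact: leq_maxr.
have : (visits X n.+1 w)%:R <= 1 + (visits X n (phi w))%:R :> R.
  by rewrite visitsS natrD lerD2r; case: (X w).
by move: qn; rewrite -natr1; lra.
Qed.

(* The limsup of the visit frequencies exceeds [q]: unlike [often_above X q],
   this set is exactly invariant. *)
Definition limsup_above X (q : R) : set T := \bigcup_k often_above X (q + k.+1%:R^-1).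

(** Passing between [w] and [phi w] costs an arbitrarily small part of the margin, so going from
    index [k] to [k.+1] in the union pays for it. *)
Lemma limsup_above_invariant X q : phi @^-1` limsup_above X q = limsup_above X q.
Proof.
have lt_k k : q + k.+2%:R^-1 < q + k.+1%:R^-1 by rewrite ltrD2l ltf_pV2 ?posrE ?ltr_nat.
by apply/seteqP; split=> w [k _ Hw]; exists k.+1 => //;
  [exact: often_above_shift Hw|exact: often_above_unshift Hw].
Qed.

(* Katznelson and Weiss: [delayed X q M] is where one has to wait more than [M]
   steps to see a visit frequency at least [q]. *)
Definition delayed X (q : R) M : set T :=
  [set w | forall n, (0 < n <= M)%N -> (visits X n w)%:R < q * n%:R].

Lemma measurable_delayed X q M : finitely_valued X -> measurable (delayed X q M).
Proof.
move=> mX; rewrite (_ : delayed X q M = \bigcap_(n in [set n | (0 < n <= M)%N])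
    [set w | (fun m => m%:R < q * n%:R) (visits X n w)]).
  apply: bigcap_measurableType => n _.
  exact: (@measurable_visits X n (fun m => m%:R < q * n%:R)).
by apply/seteqP; split=> w Hw n; exact: Hw.
Qed.

Lemma visits_covering X q M N w : 0 <= q ->
  q * (N%:R - M%:R) <= (visits X N w)%:R +
    q * (visits (fun v => `[< delayed X q M v >]) N w)%:R.
Proof.
move=> q0; elim/ltn_ind: N w => N IHN w.
have [le_NM|lt_MN] := leqP N M.
  apply: (@le_trans _ _ 0); last by rewrite addr_ge0// mulr_ge0.
  by rewrite mulr_ge0_le0// subr_le0 ler_nat.
have [Dw|nDw] := pselect (delayed X q M w).
  case: N IHN lt_MN => // N IHN lt_MN; rewrite !visitsS !natrD.
  have := IHN N (ltnSn N) (phi w); rewrite asboolT//= -natr1.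
  by have : 0 <= (X w)%:R :> R by []; lra.
have [n n_gt le_qn] : exists2 n, (0 < n <= M)%N & q * n%:R <= (visits X n w)%:R.
  apply: contrapT => nex; apply: nDw => n n_gt; rewrite ltNge; apply/negP => le_qn.
  by apply: nex; exists n.
have /andP[n0 nM] := n_gt; have nN : (n <= N)%N by apply: ltnW; apply: leq_ltn_trans lt_MN.
have := IHN (N - n)%N _ (iter n phi w); rewrite ltn_subrL n0 (leq_trans n0)// => /(_ isT).
have vE Y : visits Y N w = (visits Y n w + visits Y (N - n) (iter n phi w))%N.
  by rewrite -visitsD subnKC.
rewrite !vE !natrD natrB//.
set a := (visits _ n w)%:R in le_qn *; set b := (visits _ n w)%:R.
have : 0 <= q * b by rewrite mulr_ge0.
by lra.
Qed.

(** The mean of [visits_covering] is linear in [N] by stationarity; for [N] large the constant loss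
    [q * M] is negligible. *)
Lemma delayed_bound X q M : finitely_valued X -> 0 <= q ->
  q <= law P X true + q * Pr P (delayed X q M).
Proof.
move=> mX q0; pose D := fun w => `[< delayed X q M w >].
have DE : D @^-1` [set true] = delayed X q M.
  by apply/seteqP; split=> w /=; [move/asboolP|move=> Dw; apply/asboolP].
have mD : finitely_valued D.
  case; first by rewrite DE; exact: measurable_delayed.
  rewrite (_ : _ @^-1` _ = ~` (D @^-1` [set true])).
    by rewrite DE; apply/measurableC/measurable_delayed.
  by apply/seteqP; split=> w /=; case: (D w).
pose Y w := (X w, D w).
have mY : finitely_valued Y by exact: finitely_valued_pair.
pose g (p : bool * bool) : R := p.1%:R + q * p.2%:R.
pose c := law P X true + q * Pr P (delayed X q M).
have EY : \sum_p law P Y p * g p = c.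
  under eq_bigr do rewrite mulrDr.
  rewrite big_split/= -(law_comp_expectation P fst (fun b : bool => b%:R))//.
  rewrite -(law_comp_expectation P snd (fun b : bool => q * b%:R))//.
  rewrite !big_bool/= !mulr0 !mulr1 !addr0 mulrC; congr (_ + q * _).
  by rewrite /law -DE.
have bound N : q * (N%:R - M%:R) <= N%:R * c.
  rewrite -EY -(expectation_proc mphi phi_inv mY N g); apply: le_expectation.
    exact: finitely_valued_proc.
  move=> w; apply: le_trans (visits_covering X M N w q0) _.
  rewrite /visits !natr_sum mulr_sumr -big_split/=; apply: ler_sum => k _.
  by rewrite tnth_mktuple.
rewrite -/c leNgt; apply/negP => lt_cq.
have := bound (Num.truncn (q * M%:R / (q - c))).+1; set N := _.+1.
have : q * M%:R < (q - c) * N%:R.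
  by rewrite [ltRHS]mulrC -ltr_pdivrMr ?subr_gt0// truncnS_gt.
by lra.
Qed.

(** On [limsup_above X q] the waiting time is finite, so the delayed sets decrease to a null set as
    [M] grows and their term in [delayed_bound] disappears. *)
Lemma limsup_above_bound X q : finitely_valued X -> 0 <= q ->
  P (limsup_above X q) = 1%E -> q <= law P X true.
Proof.
move=> mX q0 P1.
have mL : measurable (limsup_above X q).
  by apply: bigcupT_measurable => k; exact: measurable_often_above.
have mDl M : measurable (delayed X q M) by exact: measurable_delayed.
have capD : Pr P (\bigcap_M delayed X q M) = 0.
  apply/eqP; rewrite eq_le Pr_ge0 andbT.
  have -> : 0 = Pr P (~` limsup_above X q) by rewrite PrC// /Pr P1/= subrr.
  apply: le_Pr; [exact: bigcapT_measurable|exact: measurableC|].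
  move=> w Dw [k _ /(_ 1%N)[n n0 qn]].
  have := Dw n I n; rewrite leqnn n0 => /(_ isT); apply/negP; rewrite -leNgt.
  by apply: le_trans qn; rewrite ler_wpM2r// lerDl.
have Dcvg : Pr P (delayed X q M) @[M --> \oo] --> (0 : R).
  rewrite -capD; apply: Pr_bigcap_cvg => // m n mn; apply/subsetPset => w Dw k /andP[k0 km].
  by apply: Dw; rewrite k0 (leq_trans km).
have cvgb : law P X true + q * Pr P (delayed X q M) @[M --> \oo] --> law P X true.
  rewrite -[X in _ --> X]addr0 -[X in _ --> _ + X](mulr0 q).
  by apply: cvgD; [exact: cvg_cst|exact: cvgMl_tmp].
by apply: (cvgr_to_ge cvgb); apply: nearW => M; exact: delayed_bound.
Qed.

(** By ergodicity the invariant set at a level [q'] strictly between the law and [q] has measure 0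
    or 1, and measure 1 would force [q'] below the law. *)
Lemma often_above_negligible X q : finitely_valued X -> law P X true < q ->
  P (often_above X q) = 0%E.
Proof.
move=> mX lt_q; have mO := measurable_often_above q mX.
set m := law P X true in lt_q; pose q' := (m + q) / 2.
have m0 : 0 <= m by exact: law_ge0.
have mq' : m < q' by rewrite /q' midf_lt.
have q'q : q' < q by rewrite /q' midf_lt.
have mL : measurable (limsup_above X q').
  by apply: bigcupT_measurable => k; exact: measurable_often_above.
have subL : often_above X q `<=` limsup_above X q'.
  move=> w Hw; pose k := Num.truncn (q - q')^-1; exists k => //.
  apply: often_above_le Hw.
  have : k.+1%:R^-1 <= q - q'.
    by rewrite invf_ple ?posrE ?subr_gt0// ltW// truncnS_gt.
  by rewrite lerBrDl.
have [P0|P1] := phi_erg mL (limsup_above_invariant X q').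
  by apply/eqP; rewrite eq_le measure_ge0 andbT -P0 le_measure// inE.
have le_q'm := limsup_above_bound mX (le_trans m0 (ltW mq')) P1.
by move: (lt_le_trans mq' le_q'm); rewrite ltxx.
Qed.

(** The upper bound is applied to [X] and to its negation, whose visits count the remaining times;
    the second application is the lower bound for [X]. *)
Lemma birkhoff_visits X : finitely_valued X ->
  {ae P, forall w, (visits X n w)%:R / n%:R @[n --> \oo] --> law P X true}.
Proof.
move=> mX; have mnX : finitely_valued (negb \o X) by exact: finitely_valued_comp.
have lawN : law P (negb \o X) true = 1 - law P X true.
  have -> : law P (negb \o X) true = law P X false.
    by congr Pr; apply/seteqP; split=> w /=; case: (X w).
  by have := law_sum P mX; rewrite big_bool/=; lra.
have ae_above Y k : finitely_valued Y ->
    {ae P, forall w, ~ often_above Y (law P Y true + k.+1%:R^-1) w}.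
  move=> mY; exists (often_above Y (law P Y true + k.+1%:R^-1)); split.
  - exact: measurable_often_above.
  - by apply: often_above_negligible; rewrite // ltrDl.
  - by move=> w /= /contrapT.
have /ae_foralln aeX := fun k => ae_above X k mX.
have /ae_foralln aenX := fun k => ae_above (negb \o X) k mnX.
apply: filterS2 aeX aenX => w nX nnX; apply/cvgrPdist_le => e e0.
pose k := Num.truncn e^-1.
have ke : k.+1%:R^-1 <= e by rewrite invf_ple ?posrE// ltW// truncnS_gt.
have below Y : ~ often_above Y (law P Y true + k.+1%:R^-1) w ->
    \forall n \near \oo, (visits Y n w)%:R <= (law P Y true + e) * n%:R.
  move=> nO; have [N HN] : exists N, forall n, (N <= n)%N ->
      (visits Y n w)%:R < (law P Y true + k.+1%:R^-1) * n%:R.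
    apply: contrapT => nex; apply: nO => N; apply: contrapT => nex'; apply: nex.
    exists N => n Nn; rewrite ltNge; apply/negP => le_n; apply: nex'; exists n => //.
  near=> n; have : (N <= n)%N by near: n; exact: nbhs_infty_ge.
  move=> /HN /ltW /le_trans; apply; rewrite ler_wpM2r// lerD2l//.
near=> n.
have n0 : 0 < n%:R :> R by rewrite ltr0n; near: n; exact: nbhs_infty_gt.
have le1 : (visits X n w)%:R <= (law P X true + e) * n%:R by near: n; exact: below.
have le2 : (visits (negb \o X) n w)%:R <= (law P (negb \o X) true + e) * n%:R.
  by near: n; exact: below.
have eqn : (visits (negb \o X) n w)%:R + (visits X n w)%:R = n%:R :> R.
  by rewrite -natrD visits_negb.
rewrite distrC ler_distl ler_pdivlMr// ler_pdivrMr// le1 andbT.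
by move: le2; rewrite lawN -eqn; lra.
Unshelve. all: by end_near. Qed.

End Birkhoff.

(** * Approximation by cylinders *)

Section Generator.
Context d (T : measurableType d) (R : realType) (P : probability T R).
Variable phi : T -> T.
Hypotheses (mphi : measurable_fun setT phi)
  (phi_inv : forall B, measurable B -> P (phi @^-1` B) = P B).
Variables (A : finType) (X : T -> A).
Hypotheses (mX : finitely_valued X)
  (X_gen : forall B : set T, measurable B ->
     <<s [set C | exists i a, C = (X \o iter i phi) @^-1` [set a]] >> B).

Lemma PrU_le (B C : set T) : measurable B -> measurable C ->
  Pr P (B `|` C) <= Pr P B + Pr P C.
Proof.
move=> mB mC; rewrite -lee_fin EFinD -!PrE//; first exact: measureU2.
exact: measurableU.
Qed.

Lemma Pr_bigsetU_le (I : Type) (s : seq I) (F : I -> set T) :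
  (forall i, measurable (F i)) ->
  Pr P (\big[setU/set0]_(i <- s) F i) <= \sum_(i <- s) Pr P (F i).
Proof.
move=> mF; elim: s => [|i s IHs]; first by rewrite !big_nil Pr_set0.
rewrite !big_cons; apply: le_trans (PrU_le _ _) _ => //.
  by apply: bigsetU_measurable.
by rewrite lerD2l.
Qed.

(** The block [proc] as a plain list: blocks of different lengths then share a type and can be cut
    into one another. *)
Definition traj n w : seq A := mkseq (fun k => X (iter k phi w)) n.

Lemma traj_proc n w : traj n w = proc phi X n w.
Proof.
by rewrite /traj /mkseq /proc /mktuple /= /image_mem -val_enum_ord -map_comp.
Qed.

Lemma size_traj n w : size (traj n w) = n.
Proof. exact: size_mkseq. Qed.

Lemma take_drop_traj k m n w : (k + m <= n)%N ->
  take m (drop k (traj n w)) = traj m (iter k phi w).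
Proof.
move=> le_n; apply: (@eq_from_nth _ (X w)) => [|i].
  by rewrite size_takel ?size_traj// size_drop size_traj leq_subRL//; lia.
rewrite size_takel ?size_drop ?size_traj; last by lia.
move=> im; rewrite nth_take// nth_drop !nth_mkseq//; last by lia.
by rewrite addnC iterD.
Qed.

Lemma take_traj m n w : (m <= n)%N -> take m (traj n w) = traj m w.
Proof. by move=> mn; rewrite -(take_drop_traj (k := 0) w mn) drop0. Qed.

Lemma measurable_traj n (Q : pred (seq A)) : measurable [set w | Q (traj n w)].
Proof.
have := measurable_event (fun t : n.-tuple A => Q t) (finitely_valued_proc mphi mX (n := n)).
by congr (measurable _); apply/seteqP; split=> w /=; rewrite traj_proc.
Qed.

Lemma measurableY (B C : set T) : measurable B -> measurable C -> measurable (B `+` C).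
Proof. by move=> mB mC; apply: measurableU; exact: measurableD. Qed.

Lemma setYP (B C : set T) w : (B `+` C) w <-> ~ (B w <-> C w).
Proof.
split=> [[[]|[]]|nBC]; [tauto|tauto|].
by have [Bw|nBw] := pselect (B w); [left|right]; split=> //; [tauto|apply: contrapT; tauto].
Qed.

Definition cylinder_approximable (B : set T) := measurable B /\
  forall e, 0 < e -> exists n (Q : pred (seq A)),
    Pr P (B `+` [set w | Q (traj n w)]) <= e.

Lemma le_Pr_setY B C B' C' : measurable B -> measurable C -> measurable B' ->
  measurable C' -> (forall w, (B w <-> C w) -> (B' w <-> C' w)) ->
  Pr P (B' `+` C') <= Pr P (B `+` C).
Proof.
move=> mB mC mB' mC' BC; apply: le_Pr; [exact: measurableY|exact: measurableY|].
by move=> w /setYP nBC'; apply/setYP => /BC.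
Qed.

Lemma approximable_setC B : cylinder_approximable B -> cylinder_approximable (~` B).
Proof.
move=> [mB apB]; split; first exact: measurableC.
move=> e e0; have [n [Q BQ]] := apB e e0; exists n, (predC Q).
apply: le_trans BQ; apply: le_Pr_setY => //; [exact: (measurable_traj n Q)|exact: measurableC|
  exact: (measurable_traj n (predC Q))|].
by move=> w; rewrite /setC /= => BQ; split=> [nB|/negP nQ]; [apply/negP|]; tauto.
Qed.

Lemma approximable_setU B C : cylinder_approximable B -> cylinder_approximable C ->
  cylinder_approximable (B `|` C).
Proof.
move=> [mB apB] [mC apC]; split; first exact: measurableU.
move=> e e0; have e20 : 0 < e / 2 by rewrite divr_gt0.
have [n [Q BQ]] := apB _ e20; have [n' [Q' CQ]] := apC _ e20.
exists (maxn n n'), (fun s => Q (take n s) || Q' (take n' s)).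
pose QQ' s := Q (take n s) || Q' (take n' s).
set D := [set w | _]; have mD : measurable D := measurable_traj (maxn n n') QQ'.
have mYB : measurable (B `+` [set w | Q (traj n w)]).
  exact: measurableY mB (measurable_traj n Q).
have mYC : measurable (C `+` [set w | Q' (traj n' w)]).
  exact: measurableY mC (measurable_traj n' Q').
have -> : e = e / 2 + e / 2 by rewrite -splitr.
apply: le_trans (lerD BQ CQ); apply: le_trans (PrU_le mYB mYC).
apply: le_Pr; [by apply: measurableY => //; exact: measurableU|exact: measurableU|].
move=> w /setYP nBC.
have DE : D w <-> (Q (traj n w) \/ Q' (traj n' w)).
  by rewrite /D/= !take_traj ?leq_maxl ?leq_maxr//; split=> /orP.
have [h|h] := pselect (B w <-> Q (traj n w)); last by left; apply/setYP.
by right; apply/setYP => h'; apply: nBC; rewrite DE /setU /=; tauto.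
Qed.

(** Half of the error is spent on truncating the union, by continuity of the measure, and half on
    approximating the resulting finite union. *)
Lemma approximable_bigcup (B : nat -> set T) :
  (forall i, cylinder_approximable (B i)) -> cylinder_approximable (\bigcup_i B i).
Proof.
move=> apB; have mB i : measurable (B i) by have [] := apB i.
have mU : measurable (\bigcup_i B i) by exact: bigcupT_measurable.
split=> // e e0; have e20 : 0 < e / 2 by rewrite divr_gt0.
pose F n := \big[setU/set0]_(i < n) B i.
have FE n : F n = \bigcup_(i < n) B i by rewrite bigcup_mkord.
have apF n : cylinder_approximable (F n).
  rewrite /F; elim: n => [|n IHn]; last by rewrite big_ord_recr; exact: approximable_setU.
  rewrite big_ord0; split=> // e' e'0; exists 0%N, xpred0.
  rewrite (_ : _ `+` _ = set0) ?Pr_set0 ?ltW//.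
  by apply/seteqP; split=> w // /setYP; apply.
have mF n : measurable (F n) by have [] := apF n.
pose G n := \bigcup_i B i `\` F n.
have mG n : measurable (G n) by exact: measurableD.
have Gcvg : Pr P (G n) @[n --> \oo] --> (0 : R).
  rewrite -(Pr_set0 P) -(_ : \bigcap_n G n = set0).
    apply: Pr_bigcap_cvg => // m n mn; apply/subsetPset => w [Uw nF]; split=> //.
    by apply: contra_not nF; rewrite !FE => -[i /= im Bi]; exists i => //=; exact: leq_trans mn.
  rewrite -subset0 => w Gw; have [[i _ Bi] _] := Gw 0%N I.
  by have [_] := Gw i.+1 I; apply; rewrite FE; exists i => /=.
have [N _ HN] : \forall n \near \oo, Pr P (G n) <= e / 2 by exact: (cvgr_le _ Gcvg _ e20).
have GN : Pr P (G N) <= e / 2 by apply: HN => /=.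
have [n [Q FQ]] := (apF N).2 _ e20; exists n, Q.
have mQ := measurable_traj n Q; set D := [set w | _] in FQ mQ *.
have -> : e = e / 2 + e / 2 by rewrite -splitr.
have mY : measurable (F N `+` D) by exact: measurableY.
apply: le_trans (lerD GN FQ); apply: le_trans (PrU_le (mG N) mY).
apply: le_Pr; [exact: measurableY|exact: measurableU|].
move=> w /setYP nUD; have [Fw|nFw] := pselect (F N w).
  right; apply/setYP => FD; apply: nUD; split=> [_|_]; first by apply/FD.
  by move: Fw; rewrite FE => -[i _ Bi]; exists i.
have [Uw|nUw] := pselect ((\bigcup_i B i) w); first by left.
by right; apply/setYP => FD; apply: nUD; tauto.
Qed.

(** The approximable sets form a sigma-algebra that contains the generating cylinders. *)
Lemma measurable_approximable (B : set T) : measurable B -> cylinder_approximable B.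
Proof.
move=> /X_gen; apply: smallest_sub; first split.
- split=> // e e0; exists 0%N, xpred0.
  rewrite (_ : _ `+` _ = set0) ?Pr_set0 ?ltW//.
  by apply/seteqP; split=> w // /setYP; apply.
- by move=> C apC; rewrite setTD; exact: approximable_setC.
- exact: approximable_bigcup.
move=> _ [i [a ->]].
have mC : measurable ((X \o iter i phi) @^-1` [set a]).
  exact: (finitely_valued_iter mphi mX).
split=> // e e0; exists i.+1, (fun s => nth a s i == a).
rewrite (_ : _ `+` _ = set0) ?Pr_set0 ?ltW//.
apply/seteqP; split=> w // /setYP; apply; rewrite /= nth_mkseq//.
by split=> /eqP.
Qed.

(** Each fibre of [Y] is approximated with error [e / #|I|], and [f] picks an index whose
    approximating event holds. Outside the union of the symmetric differences, the only such index
    is the value of [Y]. *)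
Lemma approximate_finitely_valued (I : finType) (Y : T -> I) e : finitely_valued Y ->
  0 < e -> exists m (f : seq A -> I), Pr P [set w | Y w <> f (traj m w)] <= e.
Proof.
move=> mY e0; pose i0 := Y point.
have I0 : 0 < #|I|%:R :> R by rewrite ltr0n; apply/card_gt0P; exists i0.
have /choice[nQ HnQ] : forall i, exists nQ : nat * pred (seq A),
    Pr P (Y @^-1` [set i] `+` [set w | nQ.2 (traj nQ.1 w)]) <= e / #|I|%:R.
  move=> i; have [_ ap] := measurable_approximable (mY i).
  by have [|n [Q HQ]] := ap (e / #|I|%:R); [rewrite divr_gt0|exists (n, Q)].
pose m := \max_i (nQ i).1; pose Q i s := (nQ i).2 (take (nQ i).1 s).
pose f s := odflt i0 [pick i | Q i s]; exists m, f.
pose F i := Y @^-1` [set i] `+` [set w | (nQ i).2 (traj (nQ i).1 w)].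
have mF i : measurable (F i) by apply: measurableY (mY i) _; exact: (measurable_traj _ (nQ i).2).
have -> : e = \sum_(i : I) e / #|I|%:R.
  by rewrite sumr_const -[RHS]mulr_natr divfK ?gt_eqF.
apply: (@le_trans _ _ (\sum_i Pr P (F i))); last by apply: ler_sum => i _; exact: HnQ.
apply: le_trans (Pr_bigsetU_le _ mF).
have QE i w : Q i (traj m w) = (nQ i).2 (traj (nQ i).1 w).
  by rewrite /Q take_traj//; exact: (leq_bigmax i).
apply: le_Pr.
- have mYf : finitely_valued (fun w => (Y w, f (traj m w))).
    apply: finitely_valued_pair => // i.
    have := measurable_traj m (fun s => f s == i); congr measurable.
    by apply/seteqP; split=> w /eqP.
  have := measurable_event (fun p => p.1 != p.2) mYf; congr measurable.
  by apply/seteqP; split=> w /=; [move/eqP|move/eqP].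
- exact: bigsetU_measurable.
move=> w /= Yf; rewrite -bigcup_seq; apply: contrapT => nF; apply: Yf.
have YQ i : (Y w = i) <-> Q i (traj m w).
  rewrite QE; apply: contrapT => nYQ; apply: nF; exists i; first by rewrite /= mem_index_enum.
  exact/setYP.
rewrite /f; case: pickP => [i /= /YQ //|/(_ (Y w))].
by have /YQ -> := erefl (Y w).
Qed.

End Generator.
(** * Generators *)

Section GeneratorRate.
Context d (T : measurableType d) (R : realType) (P : probability T R).
Variable phi : T -> T.
Hypotheses (mphi : measurable_fun setT phi)
  (phi_inv : forall B, measurable B -> P (phi @^-1` B) = P B).
Variables (A : finType) (X : T -> A).
Hypotheses (mX : finitely_valued X)
  (X_gen : forall B : set T, measurable B ->
     <<s [set C | exists i a, C = (X \o iter i phi) @^-1` [set a]] >> B).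

Lemma sum_tuple_prod (I : finType) n (F : 'I_n -> I -> R) :
  \sum_(t : n.-tuple I) \prod_k F k (tnth t k) = \prod_k \sum_i F k i.
Proof.
rewrite bigA_distr_bigA (reindex (fun f : {ffun 'I_n -> I} => [tuple f k | k < n]))/=.
  by apply: eq_bigr => f _; apply: eq_bigr => k _; rewrite tnth_mktuple.
exists (fun t => [ffun k => tnth t k]) => [f _|t _].
  by apply/ffunP => k; rewrite ffunE tnth_mktuple.
by apply: eq_from_tnth => k; rewrite tnth_mktuple ffunE.
Qed.

(* A block of [Y] is compared, through Gibbs' inequality, with the output of the
   channel [W] fed with the guesses [f] makes from a block of [X]. *)
Lemma entropy_proc_channel (I : finType) (Y : T -> I) (W : I -> I -> R) m
    (f : seq A -> I) n :
  finitely_valued Y -> (forall a b, 0 < W a b) -> (forall b, \sum_a W a b <= 1) ->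
  entropy P (proc phi Y n) <= entropy P (proc phi X (n + m)) +
    n%:R * \sum_p law P (fun w => (Y w, f (traj phi X m w))) p * - log2 (W p.1 p.2).
Proof.
move=> mY W0 W1.
pose V w := (proc phi Y n w, proc phi X (n + m) w).
have mpY : finitely_valued (proc phi Y n) by exact: finitely_valued_proc.
have mpX : finitely_valued (proc phi X (n + m)) by exact: finitely_valued_proc.
have mV : finitely_valued V by exact: finitely_valued_pair.
have mYf : finitely_valued (fun w => (Y w, f (traj phi X m w))).
  apply: finitely_valued_pair => // i.
  have := measurable_traj mphi mX m (fun s => f s == i); congr measurable.
  by apply/seteqP; split=> w /eqP.
(* The guess at time [k] reads the [m] letters from position [k] on, hence blocks of length [n + m].
   The weight [q] is the law of such a block times a memoryless channel. *)
pose g (u : (n + m).-tuple A) (k : 'I_n) := f (take m (drop k u)).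
pose q (p : n.-tuple I * (n + m).-tuple A) :=
  law P (proc phi X (n + m)) p.2 * \prod_k W (tnth p.1 k) (g p.2 k).
have Wp p : 0 < \prod_k W (tnth p.1 k) (g p.2 k) by apply: prodr_gt0.
apply: le_trans (entropy_comp_le P fst mV) _.
apply: le_trans (gibbs (q := q) _ _ _ _) _.
- by move=> p; exact: law_ge0.
- by move=> p; rewrite mulr_ge0 ?law_ge0// ltW.
- move=> p p0; rewrite mulr_gt0//; apply: lt_le_trans p0 _.
  by apply: le_Pr => // w /= <-.
- rewrite law_sum//.
  rewrite -(pair_bigA _ (fun t u => q (t, u)))/= exchange_big/= -(law_sum P mpX).
  apply: ler_sum => u _; rewrite /q/= -mulr_sumr -[leRHS]mulr1 ler_wpM2l ?law_ge0//.
  rewrite (sum_tuple_prod (fun k a => W a (g u k))).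
  apply: (@le_trans _ _ (\prod_(k < n) 1)); last by rewrite big1_eq.
  apply: ler_prod => k _.
  by rewrite W1 sumr_ge0// => a _; exact: ltW.
have -> : \sum_p law P V p * log2 (q p) =
    \sum_p law P V p * log2 (law P (proc phi X (n + m)) p.2) +
    \sum_p law P V p * \sum_k log2 (W (tnth p.1 k) (g p.2 k)).
  rewrite -big_split/=; apply: eq_bigr => p _; rewrite -mulrDr.
  have [law0|/negP law0] := boolP (0 < law P V p); last first.
    suff -> : law P V p = 0 by rewrite !mul0r.
    by apply/eqP; rewrite eq_le law_ge0 leNgt andbT; apply/negP.
  rewrite log2M// ?log2_prod//; apply: lt_le_trans law0 _.
  by apply: le_Pr => // w /= <-.
rewrite opprD; apply: lerD.
  rewrite -(law_comp_expectation P snd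
    (fun u => log2 (law P (proc phi X (n + m)) u)))//.
  rewrite /entropy /shannon lerN2; apply: ler_sum => u _; by rewrite xlogxE.
rewrite -(expectation_proc mphi phi_inv mYf n (fun p => - log2 (W p.1 p.2))).
rewrite -sumrN.
pose h (p : n.-tuple I * (n + m).-tuple A) := [tuple (tnth p.1 k, g p.2 k) | k < n].
have hV : proc phi (fun w => (Y w, f (traj phi X m w))) n = h \o V.
  apply/funext => w; apply: eq_from_tnth => k; rewrite !tnth_mktuple /g /V/=.
  by rewrite -traj_proc take_drop_traj ?leq_add2r ?(ltnW (ltn_ord k)).
rewrite hV (law_comp_expectation P h
  (fun t => \sum_k - log2 (W (tnth t k).1 (tnth t k).2)))//.
apply: ler_sum => p _; rewrite -mulrN ler_wpM2l ?law_ge0// -sumrN.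
by apply: ler_sum => k _; rewrite tnth_mktuple.
Qed.

(** A right guess costs [- log2 (1 - eta)], small because [eta <= 2^-1] gives
    [eta / (1 - eta) <= 2 * eta]; a wrong one costs the fixed amount [- log2 (eta / #|I|)], weighted
    by the probability of error. *)
Lemma channel_cost (I : finType) (V : T -> I * I) (eta : R) :
  finitely_valued V -> 0 < eta <= 2^-1 ->
  \sum_p law P V p * - log2 (if p.1 == p.2 then 1 - eta else eta / #|I|%:R)
    <= 2 * eta / ln 2 + Pr P [set w | (V w).1 <> (V w).2] * - log2 (eta / #|I|%:R).
Proof.
move=> mV /andP[eta0 eta2].
have -> : Pr P [set w | (V w).1 <> (V w).2] = \sum_(p | p.1 != p.2) law P V p.
  rewrite -(Pr_event P (fun p => p.1 != p.2) mV); congr Pr.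
  by apply/seteqP; split=> w /=; move/eqP.
have cost1 : - log2 (1 - eta) <= 2 * eta / ln 2.
  rewrite -log2V; last by lra.
  rewrite /log2 ler_pM2r ?invr_gt0 ?ln2_gt0//.
  apply: le_trans (ln_le_sub1 _) _; first by rewrite invr_gt0; lra.
  rewrite lerBlDr -[X in X <= _]mul1r ler_pdivrMr; last by lra.
  by nra.
rewrite (bigID (fun p => p.1 == p.2))/=; apply: lerD; last first.
  rewrite mulr_suml; apply: ler_sum => p /negbTE neq; rewrite neq.
  by [].
apply: (@le_trans _ _ (\sum_(p | p.1 == p.2) law P V p * (2 * eta / ln 2))).
  by apply: ler_sum => p /eqP ->; rewrite eqxx ler_wpM2l ?law_ge0.
rewrite -mulr_suml -[leRHS]mul1r ler_wpM2r//.
  by rewrite divr_ge0// ?mulr_ge0 ?(ltW eta0)//; exact: ltW (ln2_gt0 R).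
rewrite -(law_sum P mV) [leRHS](bigID (fun p => p.1 == p.2))/= lerDl.
by apply: sumr_ge0 => p _; exact: law_ge0.
Qed.

(** The channel bound is divided by [n]: the [m] extra letters contribute a vanishing term by
    subadditivity, and the mean channel cost [kappa] is made at most [e]. *)
Lemma entropy_rate_generator (I : finType) (Y : T -> I) : finitely_valued Y ->
  entropy_rate P phi Y <= entropy_rate P phi X.
Proof.
move=> mY; apply/ler_addgt0Pr => e e0.
have I0 : 0 < #|I|%:R :> R by rewrite ltr0n; apply/card_gt0P; exists (Y point).
have I1 : 1 <= #|I|%:R :> R by rewrite ler1n -(ltr0n R).
have ln20 := ln2_gt0 R.
(* This makes the cost [2 * eta / ln 2] of right guesses at most [e / 2]. Only then is [delta]
   chosen, so that wrong guesses, at cost [L] each, also account for at most [e / 2]. *)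
pose eta := Num.min 2^-1 (e * ln 2 / 4).
have eta0 : 0 < eta by rewrite lt_min invr_gt0 ltr0n/= !mulr_gt0// invr_gt0.
have eta2 : eta <= 2^-1 by rewrite ge_min lexx.
have etaI : 0 < eta / #|I|%:R by rewrite divr_gt0.
pose L := - log2 (eta / #|I|%:R).
have L0 : 0 <= L.
  rewrite oppr_ge0 log2_le0// ler_pdivrMr// mul1r.
  by apply: le_trans I1; apply: le_trans eta2 _; lra.
pose delta := e / 2 / (L + 1).
have delta0 : 0 < delta by rewrite !divr_gt0//; lra.
have [m [f mismatch]] := approximate_finitely_valued P mphi mX X_gen mY delta0.
pose W (a b : I) := if a == b then 1 - eta else eta / #|I|%:R.
have W0 a b : 0 < W a b by rewrite /W; case: ifP => // _; lra.
have W1 b : \sum_a W a b <= 1.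
  rewrite (bigD1 b)//= {1}/W eqxx.
  have : \sum_(a | a != b) W a b <= eta.
    apply: (@le_trans _ _ (\sum_(a : I) eta / #|I|%:R)).
      rewrite [leRHS](bigD1 b)//= -[leLHS]add0r; apply: lerD; first exact: ltW.
      by apply: ler_sum => a /negbTE ab; rewrite /W ab.
    by rewrite sumr_const -[leLHS]mulr_natr divfK ?gt_eqF.
  by lra.
pose V w := (Y w, f (traj phi X m w)).
have mV : finitely_valued V.
  apply: finitely_valued_pair => // i.
  have := measurable_traj mphi mX m (fun s => f s == i); congr measurable.
  by apply/seteqP; split=> w /eqP.
pose kappa := \sum_p law P V p * - log2 (W p.1 p.2).
have kappa_le : kappa <= e.
  have eta12 : 0 < eta <= 2^-1 by rewrite eta0 eta2.
  apply: le_trans (channel_cost mV eta12) _; rewrite -/L.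
  have -> : e = e / 2 + delta * (L + 1).
    by rewrite /delta divfK ?gt_eqF//; [rewrite -splitr|lra].
  apply: lerD; last by apply: ler_pM => //; [exact: Pr_ge0|lra].
  rewrite ler_pdivrMr//; have : eta <= e * ln 2 / 4 by rewrite ge_min lexx orbT.
  by lra.
have [cvgY _] := entropy_rateP mphi phi_inv mY.
have [cvgX _] := entropy_rateP mphi phi_inv mX.
have cvg_r : entropy P (proc phi X n) / n%:R +
    (entropy P (proc phi X m) / n%:R + e) @[n --> \oo] --> entropy_rate P phi X + (0 + e).
  apply: cvgD => //; apply: cvgD; last exact: cvg_cst.
  rewrite -(mulr0 (entropy P (proc phi X m))); apply: cvgMl_tmp.
  by rewrite -(cvg_shiftS (fun n => n%:R^-1 : R)); exact: cvg_harmonic.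
rewrite -[e in leRHS]add0r; apply: (ler_cvg_to cvgY cvg_r); near=> n.
have n0 : 0 < n%:R :> R by rewrite ltr0n; near: n; exact: nbhs_infty_gt.
rewrite ler_pdivrMr// !mulrDl !divfK ?gt_eqF// addrA.
apply: le_trans (entropy_proc_channel m f n mY W0 W1) _; apply: lerD.
  exact: entropy_proc_subadditive.
by rewrite mulrC ler_pM2r.
Unshelve. all: by end_near. Qed.

End GeneratorRate.

(** * Limits superior and code lengths *)

Section Limsup.
Variable R : realType.
Implicit Types (u : nat -> R) (c e : R).

Lemma limn_esup_le u c : (forall e, 0 < e -> \forall n \near \oo, u n <= c + e) ->
  (limn_esup (fun n => (u n)%:E) <= c%:E)%E.
Proof.
move=> uc; apply/lee_addgt0Pr => e e0; rewrite -EFinD.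
(* The limit superior is an infimum of suprema over the neighbourhoods of infinity, and the set
   where the bound holds is one of them. *)
apply: ge_ereal_inf; exists (ereal_sup ((fun n => (u n)%:E) @` [set n | u n <= c + e])).
  by exists [set n | u n <= c + e] => //; exact: uc.
by apply: ge_ereal_sup => _ [n /= un <-]; rewrite lee_fin.
Qed.

Lemma limn_esup_ge u c : (forall e, 0 < e -> ~ \forall n \near \oo, u n <= c - e) ->
  (c%:E <= limn_esup (fun n => (u n)%:E))%E.
Proof.
move=> uc; apply/lee_addgt0Pr => e e0; rewrite -leeBlDr// -EFinB.
apply: le_ereal_inf_tmp => _ [V FV <-].
have [n Vn un] : exists2 n, V n & c - e < u n.
  apply: contrapT => nex; apply: (uc e e0); apply: filterS FV => n Vn.
  by rewrite leNgt; apply/negP => un; apply: nex; exists n.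
apply: (@le_trans _ _ (u n)%:E); first by rewrite lee_fin ltW.
by apply: ereal_sup_ubound; exists n.
Qed.

Lemma limn_esup_cvg u c : u @ \oo --> c -> limn_esup (fun n => (u n)%:E) = c%:E.
Proof.
move=> uc; have ue : (u n)%:E @[n --> \oo] --> c%:E.
  by apply: cvg_EFin => //; exact: nearW.
exact: (cvg_limn_einf_sup ue).2.
Qed.

Lemma cvg_invn : n%:R^-1 @[n --> \oo] --> (0 : R).
Proof. by rewrite -(cvg_shiftS (fun n => n%:R^-1 : R)); exact: cvg_harmonic. Qed.

(** The ratio is [- xlogx n%:R^-1], also at [n = 0] where the inverse is 0, so the continuity of
    [xlogx] at 0 applies. *)
Lemma cvg_log2_div : log2 n%:R / n%:R @[n --> \oo] --> (0 : R).
Proof.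
have inv01 n : 0 <= (n%:R^-1 : R) <= 1.
  by rewrite invr_ge0 ler0n/=; case: n => [|n]; rewrite ?invr0// invf_le1// ler1n.
have := @cvg_xlogx R _ 0 inv01 (@cvg_invn); rewrite /comp xlogxE mul0r => /cvgN.
rewrite oppr0; suff -> : (fun n => log2 n%:R / n%:R) = (fun n => - xlogx n%:R^-1) :> (nat -> R).
  by [].
apply/funext => -[|n]; first by rewrite invr0 mulr0 xlogxE mul0r oppr0.
by rewrite xlogxE log2V// mulrN opprK mulrC.
Qed.

End Limsup.

(** * Entropy and mean code length *)

Section Coding.
Variable R : realType.

(** Each of the [M.+1] possible lengths contributes at most 1. Programs are not assumed prefix-free,
    hence the bound [M.+1] in place of 1; it costs only a logarithm below. *)
Lemma kraft (T : finType) (K : T -> nat) M :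
  (forall m, (#|[set t | K t == m]%SET| <= 2 ^ m)%N) -> (forall t, (K t <= M)%N) ->
  \sum_t (2 ^+ K t)^-1 <= M.+1%:R :> R.
Proof.
move=> cardK leM.
rewrite (partition_big (fun t => inord (K t) : 'I_M.+1) xpredT)//=.
have -> : M.+1%:R = \sum_(m < M.+1) 1 :> R by rewrite sumr_const card_ord.
apply: ler_sum => m _.
apply: (@le_trans _ _ (\sum_(t in [set t | K t == m]%SET) (2 ^+ m)^-1)).
  rewrite le_eqVlt; apply/orP; left; apply/eqP; apply: eq_big => t.
    by rewrite inE -val_eqE/= inordK// ltnS.
  by rewrite -val_eqE/= inordK ?ltnS// => /eqP ->.
rewrite sumr_const -[leLHS]mulr_natr mulrC ler_pdivrMr ?exprn_gt0// mul1r.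
by rewrite -natrX ler_nat.
Qed.

(** Gibbs' inequality against the weights [2 ^- K t] normalised by [M.+1]. *)
Lemma shannon_le_code_length (T : finType) (p : T -> R) (K : T -> nat) M :
  (forall t, 0 <= p t) -> \sum_t p t = 1 ->
  (forall m, (#|[set t | K t == m]%SET| <= 2 ^ m)%N) -> (forall t, (K t <= M)%N) ->
  shannon p <= \sum_t p t * (K t)%:R + log2 M.+1%:R.
Proof.
move=> p0 p1 cardK leM.
have le_gibbs : shannon p <= - \sum_t p t * log2 ((2 ^+ K t)^-1 / M.+1%:R).
  apply: gibbs => [//|t|t _|].
  - by rewrite divr_ge0// invr_ge0 exprn_ge0.
  - by rewrite divr_gt0// invr_gt0 exprn_gt0.
  - by rewrite -mulr_suml p1 ler_pdivrMr// mul1r; exact: kraft.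
have -> : log2 M.+1%:R = \sum_t p t * log2 M.+1%:R by rewrite -mulr_suml p1 mul1r.
apply: le_trans le_gibbs _; rewrite -sumrN -big_split/=.
apply: ler_sum => t _; rewrite log2M ?invr_gt0 ?exprn_gt0// !log2V ?exprn_gt0//.
by rewrite log2_pow2 -opprD mulrN opprK mulrDr.
Qed.

End Coding.

(** The tail unions [G n] contain [E n] and decrease to the set of points lying in infinitely many
    [E n], which is null. *)
Lemma Pr_cvg0_ae d (T : measurableType d) (R : realType) (P : probability T R)
    (E : nat -> set T) : (forall n, measurable (E n)) ->
  {ae P, forall w, \forall n \near \oo, ~ E n w} ->
  Pr P (E n) @[n --> \oo] --> (0 : R).
Proof.
move=> mE [N [mN PN0 subN]].
pose G n := \bigcup_(m in [set m | (n <= m)%N]) E m.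
have mG n : measurable (G n) by exact: bigcup_measurable.
have capG : Pr P (\bigcap_n G n) = 0.
  apply/eqP; rewrite eq_le Pr_ge0 andbT.
  have -> : 0 = Pr P N by rewrite /Pr PN0.
  apply: le_Pr => //; first exact: bigcapT_measurable.
  move=> w Gw; apply: subN => -[n _ nE]; have [m /= nm Em] := Gw n I.
  exact: nE Em.
have Gcvg : Pr P (G n) @[n --> \oo] --> (0 : R).
  rewrite -capG; apply: Pr_bigcap_cvg => // m n mn; apply/subsetPset => w [k /= nk Ek].
  by exists k => //=; exact: leq_trans nk.
apply: (squeeze_cvgr _ (cvg_cst 0) Gcvg); apply: nearW => n; rewrite Pr_ge0/=.
by apply: le_Pr => // w En; exists n => /=.
Qed.

(** * The full shift *)

Section Shift.
Variables (R : realType) (A : finType) (a0 : A) (mu : probability (Omega a0) R).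
Hypotheses (hinv : shift_invariant mu) (herg : ergodic mu).

Definition letter (w : Omega a0) : A := w 0%N.

Lemma iter_shift i (w : Omega a0) k : iter i Defs.shift w k = w (i + k)%N.
Proof. by elim: i k => [|i IHi] k //=; rewrite /Defs.shift IHi addnS. Qed.

Lemma letter_iter_shift i (w : Omega a0) : letter (iter i Defs.shift w) = w i.
Proof. by rewrite /letter iter_shift addn0. Qed.

Lemma finitely_valued_letter : finitely_valued letter.
Proof.
by move=> a; apply: (@sub_sigma_algebra _ setT (cylinders a0)); exists 0%N, a.
Qed.

Lemma measurable_shift : measurable_fun setT (@Defs.shift A a0).
Proof.
apply: (@measurability _ _ (Omega a0) (Omega a0) setT (@Defs.shift A a0) (cylinders a0) erefl).
move=> _ [_ [i [a ->]] <-]; rewrite setTI.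
by apply: (@sub_sigma_algebra _ setT (cylinders a0)); exists i.+1, a.
Qed.

Lemma letter_generates (B : set (Omega a0)) : measurable B ->
  <<s [set C | exists i a, C = (letter \o iter i Defs.shift) @^-1` [set a]] >> B.
Proof.
apply: sub_smallest2r; first exact: smallest_sigma_algebra.
move=> _ [i [a ->]]; exists i, a; apply/seteqP; split=> w /=;
  by rewrite letter_iter_shift.
Qed.

Lemma prefix_traj n (w : Omega a0) : Defs.prefix (A := A) w n = traj Defs.shift letter n w.
Proof. by rewrite /Defs.prefix /traj; apply: eq_mkseq => k; rewrite letter_iter_shift. Qed.

Lemma ent_rate_partition (I : finType) (Q : I -> set (Omega a0)) (Y : Omega a0 -> I) :
  (forall i, Q i = Y @^-1` [set i]) -> ent_rate mu Q = entropy_rate mu Defs.shift Y.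
Proof.
move=> QY; congr (limn _); apply/funext => n; congr (_ / _).
rewrite /part_entropy /entropy /shannon; congr (- _); apply: eq_bigr => t _.
congr (xlogx (fine (mu _))); apply/seteqP; split=> w /=.
  by move=> Qw; apply: eq_from_tnth => k; have := Qw k Logic.I; rewrite /= QY tnth_mktuple.
by move=> <- k _; rewrite /= QY tnth_mktuple.
Qed.

(** The partition by the first letter attains the supremum. Any other partition is that of the
    variable [Y] naming the cell of a point, and letters generate the sigma-algebra. *)
Lemma KS_entropyE : KS_entropy mu = (entropy_rate mu Defs.shift letter)%:E.
Proof.
apply/eqP; rewrite eq_le; apply/andP; split.
  apply: ge_ereal_sup => _ [I [Q [[mQ [Qdisj Qcover]] ->]]].
  have /choice[Y QY] : forall w, exists i, Q i w.
    by move=> w; have : setT w by []; rewrite -Qcover => -[i _ Qi]; exists i.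
  have QE i : Q i = Y @^-1` [set i].
    apply/seteqP; split=> w /=; last by move=> <-.
    move=> Qi; apply/eqP; apply: contrapT => /negP neq.
    by have : (Q (Y w) `&` Q i) w by []; rewrite Qdisj.
  rewrite (ent_rate_partition QE) lee_fin.
  apply: (entropy_rate_generator measurable_shift hinv finitely_valued_letter letter_generates).
  by move=> i; rewrite -QE.
apply: ereal_sup_ubound; exists A, (fun a => letter @^-1` [set a]); split.
  split; first exact: finitely_valued_letter.
  split; last by apply/seteqP; split=> w // _; exists (letter w).
  move=> i j ij; rewrite -subset0 => w [/= wi wj].
  by move: ij; rewrite -wi -wj eqxx.
by congr EFin; rewrite (@ent_rate_partition A _ letter).
Qed.

Definition occurs (s : seq A) (w : Omega a0) : bool := traj Defs.shift letter (size s) w == s.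

Lemma finitely_valued_occurs s : finitely_valued (occurs s).
Proof.
move=> b; have := measurable_traj measurable_shift finitely_valued_letter (size s)
  (fun u => (u == s) == b).
suff -> : occurs s @^-1` [set b] =
    [set w | (traj Defs.shift letter (size s) w == s) == b] by [].
by rewrite /occurs; apply/seteqP; split=> w /= => [->|/eqP].
Qed.

Lemma emp_freq_visits n l (t : l.-tuple A) (w : Omega a0) : (l <= n)%N ->
  emp_freq R (Defs.prefix (A := A) w n) t =
  (visits Defs.shift (occurs t) (n - l).+1 w)%:R / ((n - l).+1)%:R.
Proof.
move=> ln; rewrite /emp_freq prefix_traj size_traj; congr (_%:R / _).
rewrite /visits -sum1_card big_mkcond; apply: eq_bigr => k _.
have -> : (k \in [set i : 'I_(n - l).+1 |
    take l (drop i (traj Defs.shift letter n w)) == t]) = occurs t (iter k Defs.shift w).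
  have kl : (k + l <= n)%N by have := ltn_ord k; rewrite ltnS; lia.
  apply/idP/idP => [/set_mem|occ].
    by rewrite /= /occurs size_tuple take_drop_traj.
  by apply/mem_set; move: occ; rewrite /= /occurs size_tuple take_drop_traj.
by case: (occurs _ _).
Qed.

Lemma emp_freq_01 l (t : l.-tuple A) (s : seq A) : 0 <= emp_freq R s t <= 1.
Proof.
rewrite /emp_freq divr_ge0//= ler_pdivrMr// mul1r ler_nat.
by rewrite -[X in (_ <= X)%N]card_ord max_card.
Qed.

Lemma ae_emp_entropy_cvg : {ae mu, forall w : Omega a0, forall l,
  emp_entropy R l (Defs.prefix (A := A) w n) @[n --> \oo] -->
    entropy mu (proc Defs.shift letter l) / l%:R}.
Proof.
(* Words are countably many: enumerating them yields one null set valid for all words and all orders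
   [l]. *)
pose word k : seq A := odflt [::] (unpickle k).
have : {ae mu, forall w : Omega a0, forall k,
    (visits Defs.shift (occurs (word k)) n w)%:R / n%:R @[n --> \oo] -->
      law mu (occurs (word k)) true}.
  apply: ae_foralln => k.
  exact: (birkhoff_visits measurable_shift hinv herg (finitely_valued_occurs (word k))).
apply: filterS => w Hw l.
have Hs s : (visits Defs.shift (occurs s) n w)%:R / n%:R @[n --> \oo] -->
    law mu (occurs s) true.
  by have := Hw (pickle s); rewrite /word pickleK.
have freq_cvg (t : l.-tuple A) :
    emp_freq R (Defs.prefix (A := A) w n) t @[n --> \oo] --> law mu (proc Defs.shift letter l) t.
  have -> : law mu (proc Defs.shift letter l) t = law mu (occurs t) true.
    congr Pr; apply/seteqP; split=> v /=.
      by rewrite /occurs => <-; rewrite size_tuple traj_proc eqxx.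
    by rewrite /occurs size_tuple traj_proc => /eqP vt; apply: val_inj.
  pose u n : R := (visits Defs.shift (occurs t) n w)%:R / n%:R.
  (* A prefix of length [n] has [n - l + 1] windows of length [l], so the frequencies are read along
     a shifted index. *)
  have vcvg : u (n - l).+1 @[n --> \oo] --> law mu (occurs t) true.
    by rewrite (cvg_centern l (fun n => u n.+1)) (cvg_shiftS u); exact: Hs.
  apply: cvg_trans vcvg; apply: near_eq_cvg; near=> n.
  by rewrite emp_freq_visits//; near: n; exact: nbhs_infty_ge.
have -> : entropy mu (proc Defs.shift letter l) / l%:R =
    - (l%:R)^-1 * \sum_(t : l.-tuple A) xlogx (law mu (proc Defs.shift letter l) t).
  by rewrite /entropy /shannon mulrC mulrN mulNr.
apply: cvgMl_tmp; apply: cvg_big => [|t _]; first exact: add_continuous.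
by apply: cvg_xlogx => // n; exact: emp_freq_01.
Unshelve. all: by end_near. Qed.

End Shift.

(** * Complexity of typical sequences *)

Section Complexities.
Variables (R : realType) (A : finType) (a0 : A) (mu : probability (Omega a0) R).
Hypotheses (hinv : shift_invariant mu) (herg : ergodic mu).
Local Notation h := (entropy_rate mu Defs.shift (@letter A a0)).
Local Notation H n := (entropy mu (proc Defs.shift (@letter A a0) n)).
Local Notation word w n := (Defs.prefix (A := A) w n).

Let rateP := entropy_rateP (@measurable_shift A a0) hinv (@finitely_valued_letter A a0).

Lemma word_rate_ge0 : 0 <= h.
Proof.
apply: (cvgr_to_ge rateP.1); apply: nearW => n; rewrite divr_ge0// entropy_ge0//.
exact: (finitely_valued_proc (@measurable_shift A a0) (@finitely_valued_letter A a0)).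
Qed.

(** Pointwise, [g] is at most [h + eta], less [eps] on the low values and plus [C] on the high ones;
    for the latter [g <= C] suffices because [h] is nonnegative. *)
Lemma mean_le (T : finType) (p g : T -> R) (C eta eps : R) :
  (forall t, 0 <= p t) -> \sum_t p t = 1 -> (forall t, g t <= C) ->
  0 <= eta -> 0 <= eps ->
  \sum_t p t * g t <= h + eta - eps * \sum_(t | g t <= h - eps) p t
    + C * \sum_(t | h + eta < g t) p t.
Proof.
move=> p0 p1 gC eta0 eps0; have h0 := word_rate_ge0.
rewrite !mulr_sumr -[X in _ <= X - _ + _]mul1r -[X in _ <= X * _ - _ + _]p1 mulr_suml.
rewrite [X in _ - X + _]big_mkcond [X in _ + X]big_mkcond/= -sumrB -big_split/=.
apply: ler_sum => t _.
suff : p t * g t <= p t * (h + eta - (if g t <= h - eps then eps else 0)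
    + (if h + eta < g t then C else 0)).
  by case: ifP => _; case: ifP => _ le_t; lra.
rewrite ler_wpM2l//; have := gC t.
by case: (leP (g t) (h - eps)); case: (leP (g t) (h + eta)) => * /=; lra.
Qed.

Lemma ae_complexity_lower (K : seq A -> nat) (C n0 : nat) :
  (forall n m, (#|[set t : n.-tuple A | K t == m]%SET| <= 2 ^ m)%N) ->
  (forall s, (n0 <= size s)%N -> (K s <= C * size s)%N) ->
  {ae mu, forall w : Omega a0, forall e, 0 < e ->
     \forall n \near \oo, (K (word w n))%:R / n%:R <= h + e} ->
  {ae mu, forall w : Omega a0, forall e, 0 < e ->
     ~ \forall n \near \oo, (K (word w n))%:R / n%:R <= h - e}.
Proof.
move=> cardK KC ae_upper.
pose G n (w : Omega a0) : R := (K (word w n))%:R / n%:R.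
have mevent n (Q : pred R) : measurable [set w : Omega a0 | Q (G n w)].
  rewrite (_ : [set w | _] = [set w | Q ((K (traj Defs.shift (@letter A a0) n w))%:R / n%:R)]).
    exact: (measurable_traj (@measurable_shift A a0) (@finitely_valued_letter A a0) n
      (fun s => Q ((K s)%:R / n%:R))).
  by apply/seteqP; split=> w; rewrite /G /= prefix_traj.
have Pr_word n (Q : pred R) : Pr mu [set w : Omega a0 | Q (G n w)] =
    \sum_(t : n.-tuple A | Q ((K t)%:R / n%:R)) law mu (proc Defs.shift (@letter A a0) n) t.
  rewrite -Pr_event; last first.
    exact: (finitely_valued_proc (@measurable_shift A a0) (@finitely_valued_letter A a0)).
  by congr Pr; apply/seteqP; split=> w; rewrite /G /= prefix_traj traj_proc.
have low_null eps N : 0 < eps -> Pr mu (\bigcap_(n in [set n | (N <= n)%N])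
    [set w : Omega a0 | G n w <= h - eps]) = 0.
  move=> eps0; set F := \bigcap_(n in _) _.
  have mF : measurable F.
    by apply: bigcap_measurableType => n _; exact: (mevent n (fun x => x <= h - eps)).
  apply/eqP; rewrite eq_le Pr_ge0 andbT -(pmulr_rle0 _ eps0).
  (* Four errors of size [eta] are spent: the excess over [h], the rare values above [h + eta], and
     the two logarithms coming from the code-length bound. *)
  apply/ler_addgt0Pr => e e0; rewrite add0r; pose eta := e / 5.
  have eta0 : 0 < eta by rewrite divr_gt0.
  have bad_cvg : Pr mu [set w : Omega a0 | h + eta < G n w] @[n --> \oo] --> (0 : R).
    apply: Pr_cvg0_ae => [n|]; first exact: (mevent n (fun x => h + eta < x)).
    apply: filterS ae_upper => w Hw; apply: filterS (Hw eta eta0) => n le_n /=.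
    by apply/negP; rewrite -leNgt.
  have Cbad_cvg : C%:R * Pr mu [set w : Omega a0 | h + eta < G n w] @[n --> \oo] --> (0 : R).
    by rewrite -(mulr0 C%:R); exact: cvgMl_tmp.
  have logC_cvg : log2 C.+1%:R * n%:R^-1 @[n --> \oo] --> (0 : R).
    by rewrite -(mulr0 (log2 C.+1%:R)); apply: cvgMl_tmp; exact: cvg_invn.
  near \oo => n.
  have n_gt0 : (0 < n)%N by near: n; exact: nbhs_infty_gt.
  have n0' : 0 < n%:R :> R by rewrite ltr0n.
  have Nn : (N <= n)%N by near: n; exact: nbhs_infty_ge.
  have n0n : (n0 <= n)%N by near: n; exact: nbhs_infty_ge.
  have leC : C%:R * Pr mu [set w : Omega a0 | h + eta < G n w] <= eta.
    by near: n; exact: (cvgr_le _ Cbad_cvg _ eta0).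
  have lelogC : log2 C.+1%:R * n%:R^-1 <= eta.
    by near: n; exact: (cvgr_le _ logC_cvg _ eta0).
  have lelog : log2 n%:R / n%:R <= eta.
    by near: n; exact: (cvgr_le _ (@cvg_log2_div R) _ eta0).
  have leF : Pr mu F <= Pr mu [set w : Omega a0 | G n w <= h - eps].
    by apply: le_Pr => //; [exact: (mevent n (fun x => x <= h - eps))|move=> w; exact].
  set X := proc Defs.shift (@letter A a0) n.
  have mX : finitely_valued X.
    exact: (finitely_valued_proc (@measurable_shift A a0) (@finitely_valued_letter A a0)).
  have le_code : H n <= \sum_t law mu X t * (K t)%:R + log2 ((C * n).+1)%:R.
    have leKC (t : n.-tuple A) : (K t <= C * n)%N.
      by have := KC t; rewrite size_tuple; apply.
    exact: (shannon_le_code_length (fun t => law_ge0 mu X t) (law_sum mu mX) (cardK n) leKC).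
  have lelog2 : log2 ((C * n).+1)%:R <= log2 C.+1%:R + log2 n%:R :> R.
    rewrite -log2M// -natrM; apply: le_log2 => //.
    by rewrite ler_nat mulSn -add1n leq_add2r.
  have rate_le : h <= \sum_t law mu X t * ((K t)%:R / n%:R) +
      log2 C.+1%:R * n%:R^-1 + log2 n%:R / n%:R.
    apply: le_trans (rateP.2 n n_gt0) _; rewrite ler_pdivrMr// !mulrDl divfK ?gt_eqF//.
    rewrite -mulrA mulVf ?gt_eqF// mulr1 mulr_suml.
    under eq_bigr do rewrite -mulrA divfK ?gt_eqF//.
    by rewrite -addrA; apply: le_trans le_code _; rewrite lerD2l.
  have gC (t : n.-tuple A) : (K t)%:R / n%:R <= C%:R :> R.
    rewrite ler_pdivrMr// -natrM ler_nat.
    by have := KC t; rewrite size_tuple; apply.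
  have := mean_le (fun t => law_ge0 mu X t) (law_sum mu mX) gC (ltW eta0) (ltW eps0).
  rewrite -(Pr_word n (fun x => x <= h - eps)) -(Pr_word n (fun x => h + eta < x)).
  have : eps * Pr mu F <= eps * Pr mu [set w : Omega a0 | G n w <= h - eps].
    by rewrite ler_pM2l.
  have eE : e = eta * 5 by rewrite /eta divfK.
  by lra.
(* Null sets are gathered twice: over the starting time [N] here, then over the margins
   [k.+1%:R^-1], which stand for all [e]. *)
have ae_low k : {ae mu, forall w : Omega a0,
    ~ \forall n \near \oo, G n w <= h - k.+1%:R^-1}.
  pose F N := \bigcap_(n in [set n | (N <= n)%N])
    [set w : Omega a0 | G n w <= h - k.+1%:R^-1].
  have mF N : measurable (F N).
    by apply: bigcap_measurableType => n _; exact: (mevent n (fun x => x <= h - k.+1%:R^-1)).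
  apply: (@negligibleS _ _ _ mu (\bigcup_N F N)).
    by move=> w /= /contrapT[N _ HN]; exists N.
  apply: negligible_bigcup => N; apply/negligibleP => //.
  by apply: etrans (PrE mu (mF N)) _; rewrite low_null// invr_gt0.
have /ae_foralln := ae_low; apply: filterS => w Hw e e0 low.
pose k := Num.truncn e^-1.
have ke : k.+1%:R^-1 <= e by rewrite invf_ple ?posrE// ltW// truncnS_gt.
apply: (Hw k); apply: filterS low => n le_n; apply: le_trans le_n _.
by rewrite lerD2l lerN2.
Unshelve. all: by end_near. Qed.

End Complexities.

(** A crude bound independent of [s], which serves to make the code lengths of [Z] at most
    linear. *)
Lemma emp_entropy1_le (R : realType) (A : finType) (s : seq A) :
  emp_entropy R 1 s <= #|{: 1.-tuple A}|%:R * (2 / ln 2).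
Proof.
rewrite /emp_entropy invr1 mulN1r -sumrN mulr_natl -sumr_const; apply: ler_sum => t _.
have p01 := emp_freq_01 R t s; have /andP[p0 p1] := p01.
apply: le_trans (ler_norm _) _; rewrite normrN; apply: le_trans (xlogx_sqrt p01) _.
rewrite -[leRHS]mulr1 ler_wpM2l//; first by rewrite divr_ge0// ltW// ln2_gt0.
by rewrite -[leRHS](@sqrtr1 R) ler_wsqrtr.
Qed.

(** * Code lengths of a coarsely optimal algorithm *)

Section CodeLengths.
Variables (R : realType) (A : finType) (a0 : A) (mu : probability (Omega a0) R).
Hypotheses (hinv : shift_invariant mu) (herg : ergodic mu).
Variable Z : seq A -> seq bool.
Hypothesis hopt : coarsely_optimal R Z.
Local Notation h := (entropy_rate mu Defs.shift (@letter A a0)).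
Local Notation H n := (entropy mu (proc Defs.shift (@letter A a0) n)).
Local Notation word w n := (Defs.prefix (A := A) w n).

Let rateP := entropy_rateP (@measurable_shift A a0) hinv (@finitely_valued_letter A a0).

(** The order [k] is fixed first, with [H k / k] within [e / 3] of [h], since [f] depends on it;
    then [n] grows until the empirical entropy and [f n / n] each add at most [e / 3]. *)
Lemma coarsely_optimal_upper (w : Omega a0) e :
  (forall l, emp_entropy R l (word w n) @[n --> \oo] --> H l / l%:R) -> 0 < e ->
  \forall n \near \oo, (size (Z (word w n)))%:R / n%:R <= h + e.
Proof.
move=> Hw e0; have e30 : 0 < e / 3 by rewrite divr_gt0.
have lt_h : h < h + e / 3 by rewrite ltrDl.
near \oo => k.
have k0 : (1 <= k)%N by near: k; exact: nbhs_infty_gt.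
have Hk : H k / k%:R <= h + e / 3 by near: k; exact: (cvgr_le _ rateP.1 _ lt_h).
have [f [f0 Zf]] := hopt k0.
have lt_k : H k / k%:R < H k / k%:R + e / 3 by rewrite ltrDl.
near=> n.
have n0 : 0 < n%:R :> R by rewrite ltr0n; near: n; exact: nbhs_infty_gt.
have kn : (k <= size (word w n))%N by rewrite size_mkseq; near: n; exact: nbhs_infty_ge.
have le_f : f n / n%:R <= e / 3 by near: n; exact: (cvgr_le _ f0 _ e30).
have le_H : emp_entropy R k (word w n) <= H k / k%:R + e / 3.
  by near: n; exact: (cvgr_le _ (Hw k) _ lt_k).
have := Zf _ kn; rewrite size_mkseq => le_Z.
apply: (@le_trans _ _ (emp_entropy R k (word w n) + f n / n%:R)); last by lra.
by rewrite ler_pdivrMr// mulrDl divfK ?gt_eqF// mulrC.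
Unshelve. all: by end_near. Qed.

Lemma coarsely_optimal_linear : exists C n0 : nat,
  forall s, (n0 <= size s)%N -> (size (Z s) <= C * size s)%N.
Proof.
have [f [f0 Zf]] := hopt (leqnn 1).
have [N _ HN] : \forall n \near \oo, f n / n%:R <= 1.
  exact: (cvgr_le _ f0 _ ltr01).
pose C0 : R := #|{: 1.-tuple A}|%:R * (2 / ln 2).
exists (Num.truncn (C0 + 1)).+1, (maxn N 1) => s; rewrite geq_max => /andP[Ns s0].
have s0' : 0 < (size s)%:R :> R by rewrite ltr0n.
rewrite -(ler_nat R) natrM mulrC; apply: le_trans (Zf s s0) _.
apply: (@le_trans _ _ ((size s)%:R * (C0 + 1))); last first.
  by rewrite ler_pM2l// ltW// truncnS_gt.
rewrite mulrDr; apply: lerD; first by rewrite ler_pM2l// emp_entropy1_le.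
by rewrite mulrC -ler_pdivrMr//; apply: HN.
Qed.

End CodeLengths.

(** * Almost sure equality of the four quantities *)

Unset Implicit Arguments.
Set Strict Implicit.
Set Printing Implicit Defensive.

Theorem theorem11 (R : realType) (A : finType) (a0 : A)
    (U : seq bool -> option (seq A)) (hU : universal U)
    (mu : probability (Omega a0) R)
    (hinv : shift_invariant mu) (herg : ergodic mu)
    (Z : seq A -> seq bool) (hZ : compression_algorithm Z)
    (hopt : coarsely_optimal R Z) :
  {ae mu, forall w : Omega a0,
     K_Z R Z w = Hhat R (A:=A) w /\ Hhat R (A:=A) w = K_AIC R U w /\
     K_AIC R U w = KS_entropy mu}.
Proof.
have [K [KE [c Kc] KU]] := I_AIC_nat R a0 hU hZ.
have rateP := entropy_rateP (@measurable_shift A a0) hinv (@finitely_valued_letter A a0).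
set h := entropy_rate mu Defs.shift (@letter A a0) in rateP.
have c_cvg : c%:R * n%:R^-1 @[n --> \oo] --> (0 : R).
  by rewrite -(mulr0 c%:R); apply: cvgMl_tmp; exact: cvg_invn.
have K_le_Z (w : Omega a0) e : 0 < e -> \forall n \near \oo,
    (K (Defs.prefix (A := A) w n))%:R / n%:R <=
    (size (Z (Defs.prefix (A := A) w n)))%:R / n%:R + e :> R.
  move=> e0; near=> n.
  have n0 : 0 < n%:R :> R by rewrite ltr0n; near: n; exact: nbhs_infty_gt.
  have le_c : c%:R * n%:R^-1 <= e by near: n; exact: (cvgr_le _ c_cvg _ e0).
  apply: le_trans (lerD (lexx _) le_c).
  by rewrite -mulrDl ler_pM2r ?invr_gt0// -natrD ler_nat.
have ae_emp := ae_emp_entropy_cvg hinv herg.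
have K_upper (w : Omega a0) :
    (forall l, emp_entropy R l (Defs.prefix (A := A) w n) @[n --> \oo] -->
      entropy mu (proc Defs.shift (@letter A a0) l) / l%:R) ->
    forall e, 0 < e -> \forall n \near \oo,
      (K (Defs.prefix (A := A) w n))%:R / n%:R <= h + e.
  move=> Hw e e0; have e20 : 0 < e / 2 by rewrite divr_gt0.
  apply: filterS2 (coarsely_optimal_upper hinv hopt Hw e20) (K_le_Z w _ e20) => n.
  by rewrite -/h => h1 h2; lra.
have [C [n0 ZC]] := coarsely_optimal_linear hopt.
(* Asking for a nonempty string lets the additive constant [c] be absorbed into the linear bound. *)
have KC s : (maxn n0 1 <= size s)%N -> (K s <= (C + c) * size s)%N.
  rewrite geq_max => /andP[n0s s0]; apply: leq_trans (Kc s) _.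
  by rewrite mulnDl leq_add ?ZC// leq_pmulr.
have cardK n m : (#|[set t : n.-tuple A | K t == m]%SET| <= 2 ^ m)%N.
  by apply: card_complexity_level KU; exact: val_inj.
have ae_K_upper : {ae mu, forall w : Omega a0, forall e, 0 < e ->
    \forall n \near \oo, (K (Defs.prefix (A := A) w n))%:R / n%:R <= h + e}.
  by apply: filterS ae_emp => w Hw; exact: K_upper.
have ae_K_lower := ae_complexity_lower hinv cardK KC ae_K_upper.
apply: filterS2 ae_emp ae_K_lower => w Hw K_lower.
have K_AICE : K_AIC R U w = h%:E.
  have -> : K_AIC R U w =
      limn_esup (fun n => ((K (Defs.prefix (A := A) w n))%:R / n%:R)%:E).
    by congr limn_esup; apply/funext => n; rewrite KE -EFinM.
  by apply/eqP; rewrite eq_le limn_esup_le ?limn_esup_ge//; exact: K_upper.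
have K_ZE : K_Z R Z w = h%:E.
  apply/eqP; rewrite eq_le limn_esup_le/=; last first.
    by move=> e; exact: (coarsely_optimal_upper hinv hopt Hw).
  (* If the compression ratio stayed below [h - e], the complexity ratio, larger by at most [e / 2]
     in the long run, would stay below [h - e / 2]. *)
  apply: limn_esup_ge => e e0 Zlow; have e20 : 0 < e / 2 by rewrite divr_gt0.
  apply: (K_lower _ e20); apply: filterS2 Zlow (K_le_Z w _ e20) => n.
  by rewrite -/h => h1 h2; lra.
have HhatE : Hhat R (A := A) w = h%:E.
  apply/cvg_lim => //.
  have -> : (fun l => Hhat_l R (A := A) l w) =
      (fun l => (entropy mu (proc Defs.shift (@letter A a0) l) / l%:R)%:E).
    by apply/funext => l; exact: limn_esup_cvg.
  by apply: cvg_EFin => //; [exact: nearW|exact: rateP.1].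
by rewrite K_ZE HhatE K_AICE KS_entropyE.
Unshelve. all: by end_near. Qed.
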